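(* For every composition $\mu=(\mu_1,\dots,\mu_n)$ with nonnegative parts and largest part $L\ge1$, and every $1\le i\le n-1$: (a) if $\mu_i>\mu_{i+1}$ then $T_iF_\mu(\mathbf x;q,t)=F_{s_i\mu}(\mathbf x;q,t)$; (b) if $\mu_i=\mu_{i+1}$ then $T_iF_\mu(\mathbf x;q,t)=tF_\mu(\mathbf x;q,t)$; (c) $q^{\mu_n}F_\mu(x_1,\dots,x_n;q,t)=F_{(\mu_n,\mu_1,\dots,\mu_{n-1})}(qx_n,x_1,\dots,x_{n-1};q,t)$.
   Context: $s_i\mu$ swaps the $i$-th and $(i+1)$-th entries of $\mu$; on polynomials $s_i$ swaps $x_i$ and $x_{i+1}$; $T_i=t-\frac{tx_i-x_{i+1}}{x_i-x_{i+1}}(1-s_i)$. Multiline queues. Let $n,L$ be positive integers. A ball system is an $L\times n$ array of positions, rows $1$ (bottom) to $L$ (top), columns $1$ to $n$ (left to right), column indices mod $n$. Each position is empty or holds a ball; row $L$ has at least one ball, and row $r-1$ has at least as many balls as row $r$. A multiline queue $Q$ is a ball system with, for each $2\le r\le L$, a matching of every ball of row $r$ to a distinct ball of row $r-1$ and a labeling of balls, produced as follows. Balls of row $L$ get label $L$. Given labels of row $r$ (in $\{r,\dots,L\}$), balls of row $r$ are processed in decreasing order of label and, among equal labels, right to left; the ball $b$ in column $c$ is matched to some not-yet-matched ball $b'$ of row $r-1$, where if the position in row $r-1$, column $c$ holds a not-yet-matched ball then $b$ must be matched to it (trivially paired). $b'$ gets the label of $b$; afterwards unmatched balls of row $r-1$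 get label $r-1$. The type of $Q$ is $\mu$ with $\mu_j$ the label of the row-$1$ ball in column $j$, or $0$ if empty. Weights. $\mathrm{wt}_x(Q)=\prod_jx_j^{m_j}$, $m_j$ = number of balls in column $j$. For a nontrivial pairing $p$ from $b$ (row $r$, column $c$, label $i$) to $b'$ (row $r-1$, column $c'\ne c$): at the moment $p$ is made, a row-$(r-1)$ ball is free if not yet matched and not trivially paired ($b'$ is free); skipped balls are the free balls in columns $c+1,\dots,c'-1$ mod $n$. $\mathrm{wt}_{qt}(p)=\frac{(1-t)t^{\#\text{skipped}}}{1-q^{i-r+1}t^{\#\text{free}}}$, times $q^{i-r+1}$ if $c'<c$. $\mathrm{wt}(Q)=\mathrm{wt}_x(Q)\prod_p\mathrm{wt}_{qt}(p)$. $F_\mu(x_1,\dots,x_n;q,t)=\sum_Q\mathrm{wt}(Q)$ over $L\times n$ multiline queues of type $\mu$, $L=\max_j\mu_j$. *)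

(* Defs.v *)
From HB Require Import structures.
From mathcomp Require Import all_boot all_order all_fingroup all_algebra.
From mathcomp.multinomials Require Import mpoly.

Set Implicit Arguments.
Unset Strict Implicit.
Unset Printing Implicit Defensive.

Import GRing.Theory.

Local Open Scope ring_scope.

(* K = Q(q, t), with q and t algebraically independent. *)
Definition K : fieldType := {fraction {mpoly rat[2]}}.
Definition qvar : K := tofrac ('X_ord0 : {mpoly rat[2]}).
Definition tvar : K := tofrac ('X_ord_max : {mpoly rat[2]}).

(* Raw data on an L x n array.  Indices are shifted by one: r : 'I_L stands
   for row r.+1 counted from the bottom, c : 'I_n for column c.+1.
   [link Q r c = Some d] means that the ball in row r, column c is matched to
   the ball of the row below in column d; an empty position has label 0. *)
Record mlq_data (L n : nat) := MlqData {
  balls : {ffun 'I_L -> {set 'I_n}};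
  link  : {ffun 'I_L -> {ffun 'I_n -> option 'I_n}};
  label : {ffun 'I_L -> {ffun 'I_n -> 'I_L.+1}}
}.

Definition mlq_triple L n (Q : mlq_data L n) := (balls Q, link Q, label Q).
Definition triple_mlq L n p : mlq_data L n := MlqData p.1.1 p.1.2 p.2.
Lemma mlq_tripleK L n : cancel (@mlq_triple L n) (@triple_mlq L n).
Proof. by case. Qed.

HB.instance Definition _ L n :=
  Finite.copy (mlq_data L n) (can_type (@mlq_tripleK L n)).

Section MultilineQueues.

Variables L n : nat.
Implicit Types (Q : mlq_data L n) (r : 'I_L) (c d : 'I_n).

Definition rownum r : nat := r.+1.

(* Only used for 0 < r, where the cyclic predecessor is r - 1. *)
Definition below r : 'I_L := ord_pred r.

Definition ball_system Q : bool :=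
  [forall r : 'I_L, (rownum r == L) ==> (balls Q r != set0)] &&
  [forall r : 'I_L, (0 < r)%N ==> (#|balls Q r| <= #|balls Q (below r)|)%N].

Definition is_matching Q : bool :=
  [forall r : 'I_L, forall c : 'I_n,
    if (0 < r)%N && (c \in balls Q r)
    then [exists d in balls Q (below r), link Q r c == Some d]
    else link Q r c == None] &&
  [forall r : 'I_L, forall c1 : 'I_n, forall c2 : 'I_n, forall d : 'I_n,
    (link Q r c1 == Some d) && (link Q r c2 == Some d) ==> (c1 == c2)].

Definition is_labeling Q : bool :=
  [&& [forall r : 'I_L, forall c : 'I_n,
        (c \notin balls Q r) ==> (label Q r c == 0%N :> nat)],
      [forall r : 'I_L, forall c in balls Q r,
        (rownum r == L) ==> (label Q r c == L :> nat)],
      [forall r : 'I_L, forall c : 'I_n, forall d : 'I_n,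
        (link Q r c == Some d) ==> (label Q (below r) d == label Q r c)]
    & [forall r : 'I_L, forall d in balls Q (below r),
        (0 < r)%N && [forall c : 'I_n, link Q r c != Some d] ==>
        (label Q (below r) d == rownum (below r) :> nat)]].

(* The order in which the balls of row r are processed. *)
Definition earlier Q r c1 c2 : bool :=
  (label Q r c2 < label Q r c1)%N ||
  (label Q r c2 == label Q r c1) && (c2 < c1)%N.

(* The balls of the row below that are not yet matched when the ball in row r,
   column c is processed.  A ball trivially paired by that moment is matched,
   so this is also the set of free balls for the pairing made at that moment. *)
Definition free_balls Q r c : {set 'I_n} :=
  [set d in balls Q (below r) |
    [forall c1 : 'I_n, earlier Q r c1 c ==> (link Q r c1 != Some d)]].

Definition trivial_rule Q : bool :=
  [forall r : 'I_L, forall c in balls Q r,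
    (0 < r)%N && (c \in free_balls Q r c) ==> (link Q r c == Some c)].

Definition is_mlq Q : bool :=
  [&& ball_system Q, is_matching Q, is_labeling Q & trivial_rule Q].

Definition has_type Q (mu : 'I_n -> nat) : bool :=
  [forall r : 'I_L, (rownum r == 1%N) ==>
    [forall c : 'I_n, label Q r c == mu c :> nat]].

(* Number of steps to the right from column c to column d, mod n. *)
Definition cdist c d : nat := ((d + n - c) %% n)%N.

Definition skipped Q r c d : {set 'I_n} :=
  [set e in free_balls Q r c | (0 < cdist c e < cdist c d)%N].

(* In a multiline queue label Q r c >= rownum r, so that the subtraction in the
   exponent is not truncated. *)
Definition wt_pair Q r c d : K :=
  let e := (label Q r c - rownum r + 1)%N in
  if d == c then 1 else
    (1 - tvar) * tvar ^+ #|skipped Q r c d|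
      / (1 - qvar ^+ e * tvar ^+ #|free_balls Q r c|)
      * (if (d < c)%N then qvar ^+ e else 1).

Definition wt_qt Q : K :=
  \prod_(r < L) \prod_(c < n)
    if link Q r c is Some d then wt_pair Q r c d else 1.

Definition wt_x Q : {mpoly K[n]} :=
  \prod_(c < n) 'X_c ^+ #|[set r | c \in balls Q r]|.

Definition wt Q : {mpoly K[n]} := wt_qt Q *: wt_x Q.

End MultilineQueues.

Definition largest n (mu : 'I_n -> nat) : nat := (\max_(j < n) mu j)%N.

Definition F n (mu : 'I_n -> nat) : {mpoly K[n]} :=
  \sum_(Q : mlq_data (largest mu) n | is_mlq Q && has_type Q mu) wt Q.

Section Operators.

Variable n : nat.

(* i : 'I_n stands for the index i.+1 in {1, ..., N - 1} where N = n.+1 is the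
   number of variables; its two neighbouring positions in 'I_N are: *)
Definition pos1 (i : 'I_n) : 'I_n.+1 := widen_ord (leqnSn n) i.
Definition pos2 (i : 'I_n) : 'I_n.+1 := lift ord0 i.

Definition s (i : 'I_n) : 'S_n.+1 := tperm (pos1 i) (pos2 i).

Definition swap_comp (i : 'I_n) (mu : 'I_n.+1 -> nat) : 'I_n.+1 -> nat :=
  fun j => mu (s i j).

(* T_i on polynomials, with values in the field of rational functions. *)
Definition T (i : 'I_n) (f : {mpoly K[n.+1]}) : {fraction {mpoly K[n.+1]}} :=
  let x1 : {mpoly K[n.+1]} := 'X_(pos1 i) in
  let x2 : {mpoly K[n.+1]} := 'X_(pos2 i) in
  tofrac (tvar *: f)
  - tofrac (tvar *: x1 - x2) / tofrac (x1 - x2) * tofrac (f - msym (s i) f).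

(* (mu_N, mu_1, ..., mu_{N-1}) *)
Definition rot_comp (mu : 'I_n.+1 -> nat) : 'I_n.+1 -> nat :=
  fun j => mu (ord_pred j).

(* f(x_1, ..., x_N) |-> f(q x_N, x_1, ..., x_{N-1}) *)
Definition rot_poly (f : {mpoly K[n.+1]}) : {mpoly K[n.+1]} :=
  f \mPo [tuple (if j == ord0 then qvar else 1) *: 'X_(ord_pred j) | j < n.+1].

End Operators.

(* Main.v *)
Require Import Defs.
From mathcomp Require Import all_boot all_order all_fingroup all_algebra.
From mathcomp.multinomials Require Import mpoly.
From mathcomp Require Import zify ring.

Set Implicit Arguments.
Unset Strict Implicit.
Unset Printing Implicit Defensive.

Import Order.TTheory GRing.Theory Num.Theory.

Local Open Scope ring_scope.

(** Peeling off the bottom row gives F_mu = x^mu * sum_la a(la, mu) F_la, where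
    a(la, mu) sums the weights of the matchings between a row labelled la and
    the row below it, labelled mu.  The matchings of the balls of label l
    contribute (1 - z t^m) Tr(z^N O_1 ... O_n), with z = q^(l-r+1) and m the
    number of lower balls of label < l, a trace over the Fock space of a
    t-boson: a site creates a boson when only its upper ball has label l,
    annihilates one when only its lower ball has, acts by t^N when its lower
    ball has a smaller label, and is trivial when both balls have label l.
    A diagonal coefficient of such a product at level j is a polynomial in
    X = t^j, so the trace is the linear functional X^m |-> 1 / (1 - z t^m) on
    polynomials.  The processing order of the balls is irrelevant: carrying one
    creation operator around the circle by a a^+ = t a^+ a + (1 - t) yields
    exactly the weights of the pairings of its ball.  In this form, rotating
    the row is the cyclicity of the trace, and the action of T_i on F_la
    translates into exchange relations between two neighbouring sites, checked
    label by label. *)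

(** * The trace functional and the site operators *)

(** The weight of a pairing depends on every ball processed before it, so swapping two columns of a
    queue changes its weight in a nonlocal way. Summed over all matchings of one label, the weight
    becomes local: a product over sites in which the other sites enter only through the current
    number of bosons. No Fock space is built. Formally the functional is p |-> sum_j z^j p(t^j); its
    values on monomials keep it algebraic, without convergence in q and t. A site at height h sees j
    + h bosons, so t^N becomes t^h X. Negative heights are harmless, because 1 - t^N vanishes at N =
    0. The prefactor 1 - z t^m normalises a level without balls of label l to 1, so removing the
    balls one at a time yields exactly one denominator per nontrivial pairing. In the induction T_i
    is applied to all F_la at once. The case la_i < la_(i+1) is not among the relations to be proved
    and comes from the quadratic relation of T_i; this dictates the identities required of a(la,
    mu). *)

Section GeometricFunctional.

Variables (k : fieldType) (t z : k).
Hypothesis zt_neq1 : forall m, 1 - z * t ^+ m != 0.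

(** Formally the series sum_j z^j p(t^j), that is, the trace of z^N p(t^N). *)
Definition tau (p : {poly k}) : k := \sum_(i < size p) p`_i / (1 - z * t ^+ i).

Lemma tau_widen m (p : {poly k}) : (size p <= m)%N ->
  tau p = \sum_(i < m) p`_i / (1 - z * t ^+ i).
Proof.
move=> le_pm; rewrite /tau (big_ord_widen _ (fun i => p`_i / (1 - z * t ^+ i)) le_pm).
rewrite big_mkcond; apply: eq_bigr => i _; case: ltnP => // le_pi.
by rewrite nth_default // mul0r.
Qed.

Lemma tauD p r : tau (p + r) = tau p + tau r.
Proof.
pose m := maxn (size p) (size r).
rewrite (@tau_widen m p) ?leq_maxl // (@tau_widen m r) ?leq_maxr //.
rewrite (@tau_widen m) ?size_polyD // -big_split; apply: eq_bigr => i _.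
by rewrite coefD mulrDl.
Qed.

Lemma tauZ a p : tau (a *: p) = a * tau p.
Proof.
rewrite (tau_widen (size_scale_leq a p)) /tau big_distrr; apply: eq_bigr => i _.
by rewrite /= coefZ mulrA.
Qed.

Lemma tau0 : tau 0 = 0.
Proof. by rewrite /tau size_poly0 big_ord0. Qed.

Lemma tau_sum I (r : seq I) (P : pred I) (G : I -> {poly k}) :
  tau (\sum_(i <- r | P i) G i) = \sum_(i <- r | P i) tau (G i).
Proof. exact: (big_morph tau tauD tau0). Qed.

Lemma tauXn m : tau 'X^m = (1 - z * t ^+ m)^-1.
Proof.
rewrite (@tau_widen m.+1) ?size_polyXn // (bigD1 ord_max) //= coefXn eqxx mul1r.
rewrite big1 ?addr0 // => i; rewrite coefXn -val_eqE /= => /negPf->.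
by rewrite mul0r.
Qed.

(** In the series sum_j z^j p(t^j), replacing X by tX and multiplying by z shifts j by one, which
    loses only the term j = 0. *)
Lemma tau_shift p : z * tau (p \Po (t *: 'X)) = tau p - p.[1].
Proof.
rewrite -[p]coefK poly_def.
rewrite linear_sum /= !tau_sum horner_sum big_distrr -sumrB /=.
apply: eq_bigr => i _; rewrite comp_polyZ comp_Xn_poly exprZn !tauZ tauXn.
rewrite hornerZ hornerXn expr1n mulr1.
by field; rewrite zt_neq1.
Qed.

End GeometricFunctional.

(** * Heights and ball counts *)

Section Heights.

Variable n : nat.
Implicit Types (la mu : 'I_n -> nat) (l : nat) (c d e : 'I_n).

(** The number of bosons just before site j, relative to the number at the start. *)
Definition hgt l la mu (j : nat) : int :=
  \sum_(c < n | (c < j)%N) ((la c == l)%:Z - (mu c == l)%:Z).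

Definition zero_at (f : 'I_n -> nat) c : 'I_n -> nat :=
  fun c' => if c' == c then 0%N else f c'.

Definition balanced_at l la mu := #|[set c | la c == l]| == #|[set c | mu c == l]|.

Definition nfree mu (a b : nat) := #|[set e : 'I_n | (0 < mu e)%N & (a <= e < b)%N]|.

Lemma cdistE c d : cdist c d = (if (c <= d)%N then d - c else d + n - c)%N.
Proof.
have := ltn_ord c; have := ltn_ord d; rewrite /cdist; case: (leqP c d) => cd dn cn.
  by rewrite (_ : d + n - c = d - c + n)%N; [rewrite modnDr modn_small; lia | lia].
by rewrite modn_small; lia.
Qed.

(** The number of skipped balls when the whole lower row is still free. *)
Definition nskip mu c d :=
  #|[set e : 'I_n | (0 < mu e)%N & (0 < cdist c e < cdist c d)%N]|.

Lemma hgt0 l la mu : hgt l la mu 0 = 0.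
Proof. by rewrite /hgt big1. Qed.

Lemma hgtS l la mu (c : 'I_n) :
  hgt l la mu c.+1 = hgt l la mu c + ((la c == l)%:Z - (mu c == l)%:Z).
Proof.
rewrite /hgt (bigD1 c) //= addrC; congr (_ + _); apply: eq_bigl => c'.
by rewrite -val_eqE /= ltnS [RHS]ltn_neqAle andbC.
Qed.

Lemma hgt_full l la mu :
  hgt l la mu n = #|[set c | la c == l]|%:Z - #|[set c | mu c == l]|%:Z.
Proof.
rewrite /hgt (eq_bigl xpredT) => [|c]; last by rewrite ltn_ord.
have cardE (f : 'I_n -> nat) : \sum_(c < n) (f c == l)%:Z = #|[set c | f c == l]|%:Z.
  rewrite -sum1_card (big_morph Posz PoszD (erefl _)) [RHS]big_mkcond /=.
  by apply: eq_bigr => c _; rewrite inE; case: eqP.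
by rewrite sumrB !cardE.
Qed.

(** The height starts at 0 and moves by steps of at most one, so its first negative value follows a
    downward step from 0. *)
Lemma hgt_cross l la mu j : (j <= n)%N -> hgt l la mu j < 0 ->
  exists2 c : 'I_n, hgt l la mu c = 0 & (la c != l) && (mu c == l).
Proof.
move=> le_jn hj; have ex_neg : exists i, (hgt l la mu i < 0) by exists j.
case: (ex_minnP ex_neg) => -[|i]; rewrite ?hgt0 ?ltxx // => hi min_i.
have lt_in : (i < n)%N := leq_trans (min_i _ hj) le_jn.
move: hi; rewrite (hgtS _ _ _ (Ordinal lt_in)) => hi.
have ni : ~~ (hgt l la mu i < 0) by apply/negP => /min_i; rewrite ltnn.
exists (Ordinal lt_in); move: ni hi => /=; do 2!case: eqP => ? /=; lia.
Qed.

Lemma hgt_zero_bot l la mu d j : (0 < l)%N -> mu d = l ->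
  hgt l la (zero_at mu d) j = hgt l la mu j + (d < j)%N%:Z.
Proof.
move=> l_gt0 mu_d; rewrite /hgt (bigID (pred1 d)) [in RHS](bigID (pred1 d)) /=.
rewrite addrAC; congr (_ + _); last first.
  by apply: eq_bigr => c /andP[_ /negPf c_d]; rewrite /zero_at c_d.
rewrite !big_mkcondl !big_pred1_eq /zero_at eqxx mu_d eqxx.
by case: ltnP => _; rewrite ?addr0 // (ltn_eqF l_gt0); lia.
Qed.

Lemma hgt_zero_top l la mu c j : (0 < l)%N -> la c = l ->
  hgt l (zero_at la c) mu j = hgt l la mu j - (c < j)%N%:Z.
Proof.
move=> l_gt0 la_c; rewrite /hgt (bigID (pred1 c)) [in RHS](bigID (pred1 c)) /=.
rewrite addrAC; congr (_ + _); last first.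
  by apply: eq_bigr => e /andP[_ /negPf e_c]; rewrite /zero_at e_c.
rewrite !big_mkcondl !big_pred1_eq /zero_at eqxx la_c eqxx.
by case: ltnP => _; rewrite ?subr0 // (ltn_eqF l_gt0); lia.
Qed.

Lemma nfree_nil mu a : nfree mu a a = 0%N.
Proof. by apply: eq_card0 => e; rewrite !inE; lia. Qed.

Lemma nfreeS mu a d : (a <= d)%N ->
  nfree mu a d.+1 = (nfree mu a d + (0 < mu d)%N)%N.
Proof.
move=> le_ad; rewrite /nfree (cardsD1 d) addnC.
have -> : d \in [set e : 'I_n | (0 < mu e)%N & (a <= e < d.+1)%N] = (0 < mu d)%N.
  by rewrite inE ltnSn le_ad !andbT.
congr addn; apply: eq_card => e; rewrite !inE -val_eqE /=.
by rewrite andbCA; congr (_ && _); lia.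
Qed.

Lemma nfree_cat mu a b m : (a <= b <= m)%N ->
  nfree mu a m = (nfree mu a b + nfree mu b m)%N.
Proof.
move=> abm; rewrite /nfree -cardsUI addnC [X in (X + _)%N](_ : _ = 0%N).
  by rewrite add0n; apply: eq_card => e; rewrite !inE; case: (0 < mu e)%N; lia.
by apply: eq_card0 => e; rewrite !inE; case: (0 < mu e)%N; lia.
Qed.

Lemma nskip_right mu c d : (c < d)%N -> nskip mu c d = nfree mu c.+1 d.
Proof.
move=> cd; apply: eq_card => e; rewrite !inE; congr (_ && _).
have := ltn_ord e; have := ltn_ord d; rewrite !cdistE.
by case: (leqP c e); case: (leqP c d); lia.
Qed.

Lemma nskip_left mu c d : (d < c)%N ->
  nskip mu c d = (nfree mu c.+1 n + nfree mu 0 d)%N.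
Proof.
move=> dc; rewrite /nskip /nfree -cardsUI addnC [X in (X + _)%N](_ : _ = 0%N).
  apply: eq_card => e; rewrite !inE; have := ltn_ord e; have := ltn_ord c.
  by rewrite !cdistE; case: (0 < mu e)%N; case: (leqP c e); case: (leqP c d); lia.
by apply: eq_card0 => e; rewrite !inE; have := ltn_ord c; case: (0 < mu e)%N; lia.
Qed.

Lemma card_lower j l mu d : (j <= l)%N -> mu d = l ->
  #|[set e | (0 < zero_at mu d e < j)%N]| = #|[set e | (0 < mu e < j)%N]|.
Proof.
move=> le_jl mu_d; apply: eq_card => e; rewrite !inE /zero_at.
by case: eqP => // ->; rewrite mu_d; lia.
Qed.

End Heights.

Section Levels.

Variables (k : fieldType) (t : k) (n : nat).
Hypothesis t_neq0 : t != 0.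
Implicit Types (la mu : 'I_n -> nat) (l : nat).

(* The coefficient of the operator at a site with upper label a and lower label
   m (0 for an empty position), in the trace of level l; v X stands for t^N. *)
Definition cfac l a m (v : k) : {poly k} :=
  if a == l then (if (0 < m < l)%N then 0 else 1)
  else if m == l then 1 - v *: 'X
  else if (0 < m < l)%N then v *: 'X else 1.

Definition lpoly l la mu : {poly k} :=
  \prod_(c < n) cfac l (la c) (mu c) (t ^ hgt l la mu c).

(* X = 1 means starting without bosons: a height below 0 then forces an
   annihilation operator to act on the vacuum. *)
Lemma lpoly_root1 l la mu j : (j <= n)%N -> hgt l la mu j < 0 ->
  (lpoly l la mu).[1] = 0.
Proof.
move=> le_jn /(hgt_cross le_jn)[c hc /andP[/negPf la_c mu_c]].
rewrite /lpoly horner_prod (bigD1 c) //= hc /cfac la_c mu_c expr0z.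
by rewrite !hornerE subrr mul0r.
Qed.

Section Insertion.

Variables (l : nat) (la mu : 'I_n -> nat).
Hypotheses (l_gt0 : (0 < l)%N) (mu_le : forall c, (mu c <= l)%N).

(** [lpoly] with one extra boson at the sites from j on: a creation operator inserted just before
    site j. *)
Definition ipoly (j : nat) : {poly k} :=
  \prod_(c < n) cfac l (la c) (mu c) (t ^ (hgt l la mu c + (j <= c)%N%:Z)).

(** Moving the creation operator past site d is free at an empty position and costs t at a smaller
    label. A ball labelled l splits the term into passing and absorption, by 1 - tvX = t (1 - vX) +
    (1 - t), or by 1 = t + (1 - t) when the upper label is l as well. *)
Lemma ipoly_step (d : 'I_n) : ipoly d =
  t ^+ (0 < mu d)%N *: ipoly d.+1 +
  (if mu d == l then (1 - t) *: lpoly l la (zero_at mu d) else 0).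
Proof.
pose Z := \prod_(c < n | c != d)
  cfac l (la c) (mu c) (t ^ (hgt l la mu c + (d < c)%N%:Z)).
have E1 : ipoly d = cfac l (la d) (mu d) (t ^ (hgt l la mu d + 1)) * Z.
  rewrite /ipoly (bigD1 d) //= leqnn; congr (_ * _).
  apply: eq_bigr => c c_d; rewrite leq_eqVlt (_ : (d == c :> nat) = false) //.
  by rewrite eq_sym; apply/negbTE.
have E2 : ipoly d.+1 = cfac l (la d) (mu d) (t ^ (hgt l la mu d)) * Z.
  by rewrite /ipoly (bigD1 d) //= ltnn addr0.
have E3 : mu d = l -> lpoly l la (zero_at mu d) = Z.
  move=> mu_d; rewrite /lpoly (bigD1 d) //= {1 2}/zero_at eqxx.
  rewrite {1}/cfac /= (ltn_eqF l_gt0) if_same mul1r; apply: eq_bigr => c c_d.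
  by rewrite (@hgt_zero_bot n l la mu) // /zero_at (negPf c_d).
rewrite E1 E2 expfzDr // expr1z /cfac.
case: (mu d =P l) => [mu_d|mu_d].
  rewrite E3 // mu_d ltnn andbF l_gt0 expr1.
  by case: eqP => _; rewrite -!mul_polyC ?rmorphB ?rmorphM /=; ring.
have := mu_le d; case: posnP => [-> _|mu_d0 le_l].
  by rewrite /= if_same expr0 scale1r addr0.
have -> : (mu d < l)%N by lia.
by case: eqP => _; rewrite -!mul_polyC ?rmorphM /=; ring.
Qed.

Lemma ipoly_telescope a b : (a <= b <= n)%N ->
  ipoly a = \sum_(d < n | (a <= d < b)%N && (mu d == l))
     ((1 - t) * t ^+ nfree mu a d) *: lpoly l la (zero_at mu d)
   + t ^+ nfree mu a b *: ipoly b.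
Proof.
elim: b => [|b IHb] /andP[le_ab le_bn].
  move: le_ab; rewrite leqn0 => /eqP->.
  by rewrite nfree_nil expr0 scale1r big1 ?add0r // => d; lia.
case: (ltngtP a b.+1) le_ab => // [lt_ab _|-> _]; last first.
  by rewrite nfree_nil expr0 scale1r big1 ?add0r // => d; lia.
rewrite IHb; last by lia.
pose d := Ordinal le_bn.
have -> : ipoly b = ipoly d by [].
have -> : nfree mu a b = nfree mu a d by [].
rewrite ipoly_step scalerDr [X in _ + X = _]addrC addrA; congr (_ + _).
  rewrite [RHS](bigID (pred1 d)) /= addrC; congr (_ + _).
    rewrite (eq_bigl (fun e => (e == d) && (mu e == l))) => [|e]; last first.
      by rewrite -val_eqE /=; lia.
    rewrite big_mkcondr /=.
    by rewrite big_pred1_eq; case: eqP => _; rewrite ?scaler0 // scalerA mulrC.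
  by apply: eq_bigl => e; rewrite -val_eqE /=; lia.
by rewrite scalerA (@nfreeS n mu a d) // exprD.
Qed.

End Insertion.

End Levels.

(** * The weight of a single level *)

Section LevelWeights.

Variables (k : fieldType) (t z : k) (n : nat).
Hypothesis t_neq0 : t != 0.
Hypothesis zt_neq1 : forall m, 1 - z * t ^+ m != 0.
Implicit Types (la mu : 'I_n -> nat) (l : nat) (c d e : 'I_n).

(** Over an empty position the ball in column c is a bare creation operator: deleting it lowers all
    later heights by one, which the extra boson of [ipoly] restores. *)
Lemma lpoly_zero_top l la mu c : (0 < l)%N -> la c = l -> mu c = 0%N ->
  lpoly t l la mu = ipoly t l (zero_at la c) mu c.+1.
Proof.
move=> l_gt0 la_c mu_c; rewrite /lpoly /ipoly; apply: eq_bigr => e _.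
rewrite hgt_zero_top // subrK; rewrite /cfac /zero_at.
by case: (e =P c) => // ->; rewrite la_c mu_c eqxx (ltn_eqF l_gt0).
Qed.

Lemma ipoly_last l la mu : ipoly t l la mu n = lpoly t l la mu.
Proof.
by apply: eq_bigr => e _; rewrite leqNgt ltn_ord /= addr0.
Qed.

Lemma cfac_comp l a m v : cfac l a m (v * t) = cfac l a m v \Po (t *: 'X) :> {poly k}.
Proof.
rewrite /cfac; case: ifP => _; first by case: ifP; rewrite ?rmorph0 ?rmorph1.
case: ifP => _; first by rewrite comp_polyB comp_polyZ comp_polyX scalerA -polyC1 comp_polyC.
by case: ifP => _; rewrite ?rmorph1 // comp_polyZ comp_polyX scalerA.
Qed.

Lemma ipoly_first l la mu : ipoly t l la mu 0 = lpoly t l la mu \Po (t *: 'X).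
Proof.
rewrite /ipoly /lpoly rmorph_prod; apply: eq_bigr => e _ /=.
by rewrite expfzDr // expr1z cfac_comp.
Qed.

(* Carry the waiting ball of column c once around the circle: it is absorbed at
   one of the balls labelled l, or comes back with a factor z t^#free. *)
Lemma tau_insert l la mu c : (0 < l)%N -> (forall e, (mu e <= l)%N) ->
  balanced_at l la mu -> la c = l -> mu c = 0%N ->
  (1 - z * t ^+ #|[set e | (0 < mu e)%N]|) * tau t z (lpoly t l la mu) =
  \sum_(d | mu d == l) (1 - t) * t ^+ nskip mu c d * z ^+ (d < c)%N
     * tau t z (lpoly t l (zero_at la c) (zero_at mu d)).
Proof.
move=> l_gt0 mu_le bal la_c mu_c.
set la' := zero_at la c; set ip := ipoly t l la' mu.
have lt_cn := ltn_ord c.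
have -> : #|[set e | (0 < mu e)%N]| = (nfree mu c.+1 n + nfree mu 0 c.+1)%N.
  rewrite addnC -nfree_cat //; apply: eq_card => e.
  by rewrite !inE ltn_ord leq0n !andbT.
rewrite (lpoly_zero_top l_gt0 la_c mu_c) -/la' -/ip.
(* Without the ball of column c the total height is -1, so the boundary term of [tau_shift]
   vanishes. *)
have wrap : tau t z (ip n) = z * tau t z (ip 0%N).
  rewrite /ip ipoly_last ipoly_first tau_shift // (@lpoly_root1 _ _ _ _ _ _ n) ?subr0 //.
  rewrite hgt_zero_top // lt_cn hgt_full (eqP bal) subrr; lia.
have up : tau t z (ip c.+1) = \sum_(d < n | (c.+1 <= d < n)%N && (mu d == l))
     (1 - t) * t ^+ nfree mu c.+1 d * tau t z (lpoly t l la' (zero_at mu d))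
   + t ^+ nfree mu c.+1 n * tau t z (ip n).
  rewrite [in LHS]/ip (@ipoly_telescope _ _ _ t_neq0 l la' mu l_gt0 mu_le _ n) ?lt_cn ?leqnn //.
  by rewrite tauD tauZ tau_sum; congr (_ + _); apply: eq_bigr => d _; rewrite tauZ.
have down : tau t z (ip 0%N) = \sum_(d < n | (0 <= d < c.+1)%N && (mu d == l))
     (1 - t) * t ^+ nfree mu 0 d * tau t z (lpoly t l la' (zero_at mu d))
   + t ^+ nfree mu 0 c.+1 * tau t z (ip c.+1).
  rewrite [in LHS]/ip (@ipoly_telescope _ _ _ t_neq0 l la' mu l_gt0 mu_le _ c.+1) ?lt_cn ?leqnn //.
  by rewrite tauD tauZ tau_sum; congr (_ + _); apply: eq_bigr => d _; rewrite tauZ.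
rewrite (bigID (fun d : 'I_n => c < d)%N) /=.
rewrite [X in _ = X + _](_ : _ = \sum_(d < n | (c.+1 <= d < n)%N && (mu d == l))
     (1 - t) * t ^+ nfree mu c.+1 d * tau t z (lpoly t l la' (zero_at mu d))); last first.
  apply: eq_big => [d|d /andP[_ cd]]; first by rewrite ltn_ord andbT andbC.
  by rewrite nskip_right // ltnNge ltnW // mulr1.
rewrite [X in _ = _ + X](_ : _ = z * t ^+ nfree mu c.+1 n *
     \sum_(d < n | (0 <= d < c.+1)%N && (mu d == l))
     (1 - t) * t ^+ nfree mu 0 d * tau t z (lpoly t l la' (zero_at mu d))); last first.
  rewrite big_distrr /=; apply: eq_big => [d|d /andP[/eqP mu_d]].
    by rewrite -leqNgt ltnS andbC.
  have : d != c by apply: contraTneq isT => dc; move: mu_d; rewrite dc mu_c; lia.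
  rewrite -val_eqE -leqNgt leq_eqVlt /= => /negPf-> /= dc.
  by rewrite nskip_left // dc expr1 exprD; ring.
(* The two passes give x = S1 + u z (S2 + v x), which is solved for x. *)
move: up; rewrite wrap down; set S1 := \sum_(_ < _ | _) _; set S2 := \sum_(_ < _ | _) _.
move=> up; rewrite mulrBl mul1r {1}up exprD.
by move: (tau _ _ _) (t ^+ _) (t ^+ _) => x u v; ring.
Qed.

Lemma lpoly_trivial l la mu c : (0 < l)%N -> la c = l -> mu c = l ->
  lpoly t l la mu = lpoly t l (zero_at la c) (zero_at mu c).
Proof.
move=> l_gt0 la_c mu_c; apply: eq_bigr => e _.
rewrite (@hgt_zero_bot n l (zero_at la c) mu) // hgt_zero_top // subrK /zero_at.
by case: (e =P c) => // ->; rewrite la_c mu_c /cfac eqxx ltnn andbF (ltn_eqF l_gt0).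
Qed.

(** This encodes trivial pairing: a ball labelled l above a ball that is still unmatched must pass
    its label on to it, so no smaller label can stand there. *)
Lemma lpoly_clash l la mu c : la c = l -> (0 < mu c < l)%N -> lpoly t l la mu = 0.
Proof.
by move=> la_c mu_c; rewrite /lpoly (bigD1 c) //= /cfac la_c eqxx mu_c mul0r.
Qed.

(** Level j treats balls of larger label as empty positions, since they are matched earlier. *)
Lemma lpoly_lower j l la mu c d : (0 < j < l)%N -> la c = l -> mu d = l ->
  lpoly t j la mu = lpoly t j (zero_at la c) (zero_at mu d).
Proof using.
clear t_neq0 zt_neq1.
move=> /andP[j_gt0 lt_jl] la_c mu_d.
have Et e : (zero_at la c e == j) = (la e == j).
  by rewrite /zero_at; case: (e =P c) => // ->; rewrite la_c; lia.
have Eb e : (zero_at mu d e == j) = (mu e == j).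
  by rewrite /zero_at; case: (e =P d) => // ->; rewrite mu_d; lia.
apply: eq_bigr => e _; rewrite (_ : hgt _ (zero_at _ _) _ _ = hgt j la mu e).
  rewrite /cfac Et Eb (_ : (0 < zero_at mu d e < j)%N = (0 < mu e < j)%N) //.
  by rewrite /zero_at; case: (e =P d) => // ->; rewrite mu_d; lia.
by apply: eq_bigr => e' _; rewrite Et Eb.
Qed.

Lemma lpoly_absent l la mu : (forall e, la e != l) -> (forall e, mu e != l) ->
  lpoly t l la mu = 'X^#|[set e | (0 < mu e < l)%N]|.
Proof.
move=> la_l mu_l; rewrite -sum1_card -prodrXr /lpoly [RHS]big_mkcond /=.
apply: eq_bigr => e _; rewrite inE /cfac (negPf (la_l e)) (negPf (mu_l e)).
rewrite /hgt big1 => [|e' _]; first by rewrite expr0z scale1r expr1.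
by rewrite (negPf (la_l e')) (negPf (mu_l e')).
Qed.

Definition lev l la mu : k :=
  (1 - z * t ^+ #|[set e | (0 < mu e < l)%N]|) * tau t z (lpoly t l la mu).

Lemma lev_absent l la mu : (forall e, la e != l) -> (forall e, mu e != l) ->
  lev l la mu = 1.
Proof.
by move=> la_l mu_l; rewrite /lev lpoly_absent // tauXn divff.
Qed.

Lemma lev_lower j l la mu c d : (0 < j < l)%N -> la c = l -> mu d = l ->
  lev j la mu = lev j (zero_at la c) (zero_at mu d).
Proof using.
clear t_neq0 zt_neq1.
move=> jl la_c mu_d; rewrite /lev -(lpoly_lower jl la_c mu_d).
by rewrite (@card_lower n j l) //; lia.
Qed.

Lemma lev_trivial l la mu c : (0 < l)%N -> la c = l -> mu c = l ->
  lev l la mu = lev l (zero_at la c) (zero_at mu c).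
Proof.
by move=> l_gt0 la_c mu_c; rewrite /lev -lpoly_trivial // (@card_lower n l l).
Qed.

Lemma lev_clash l la mu c : la c = l -> (0 < mu c < l)%N -> lev l la mu = 0.
Proof. by move=> la_c mu_c; rewrite /lev (lpoly_clash la_c mu_c) tau0 mulr0. Qed.

(** The coefficients are the weights of the nontrivial pairings of a ball that finds the whole lower
    row free. *)
Lemma lev_insert l la mu c : (0 < l)%N -> (forall e, (mu e <= l)%N) ->
  balanced_at l la mu -> la c = l -> mu c = 0%N ->
  lev l la mu = \sum_(d | mu d == l) (1 - t) * t ^+ nskip mu c d
     / (1 - z * t ^+ #|[set e | (0 < mu e)%N]|) * z ^+ (d < c)%N
     * lev l (zero_at la c) (zero_at mu d).
Proof.
move=> l_gt0 mu_le bal la_c mu_c.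
have nz := zt_neq1 #|[set e | (0 < mu e)%N]|.
apply: (mulfI nz); rewrite [in LHS]/lev mulrCA (tau_insert l_gt0 mu_le bal la_c mu_c) !big_distrr /=.
apply: eq_bigr => d /eqP mu_d; rewrite /lev (card_lower (leqnn l) mu_d).
by move: (tau _ _ _) (1 - z * t ^+ #|[set e | (0 < mu e < l)%N]|) => x y; field.
Qed.

End LevelWeights.

(** * Matchings between two rows *)

Section RowMatchings.

Variables (n rr : nat).
Implicit Types (la mu : 'I_n -> nat) (c d e : 'I_n) (f : {ffun 'I_n -> option 'I_n}).

Definition processed_before la c1 c2 : bool :=
  (la c2 < la c1)%N || (la c2 == la c1) && (c2 < c1)%N.

Definition row_free la mu f c : {set 'I_n} :=
  [set d | (0 < mu d)%N &
    [forall c1, processed_before la c1 c ==> (f c1 != Some d)]].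

(* rr is the number of the upper row; la and mu are the labels of the upper and
   of the lower row, with 0 at the empty positions. *)
Definition row_matching la mu f : bool :=
  [&& [forall c, if (0 < la c)%N then [exists d, (0 < mu d)%N && (f c == Some d)]
                 else f c == None],
      [forall c1, forall c2, forall d,
        (f c1 == Some d) && (f c2 == Some d) ==> (c1 == c2)],
      [forall c, forall d, (f c == Some d) ==> (mu d == la c)],
      [forall d, (0 < mu d)%N && [forall c, f c != Some d] ==> (mu d == rr.-1)]
    & [forall c, (0 < la c)%N && (c \in row_free la mu f c) ==> (f c == Some c)]].

Record row_matching_spec la mu f : Prop := RowMatchingSpec {
  rm_some : forall c, (0 < la c)%N -> exists2 d, (0 < mu d)%N & f c = Some d;
  rm_none : forall c, la c = 0%N -> f c = None;
  rm_inj : forall c1 c2 d, f c1 = Some d -> f c2 = Some d -> c1 = c2;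
  rm_label : forall c d, f c = Some d -> mu d = la c;
  rm_free : forall d, (0 < mu d)%N -> (forall c, f c <> Some d) -> mu d = rr.-1;
  rm_trivial : forall c, (0 < la c)%N -> c \in row_free la mu f c -> f c = Some c
}.

Lemma row_matchingP la mu f :
  reflect (row_matching_spec la mu f) (row_matching la mu f).
Proof.
apply: (iffP and5P) => [[/forallP h1 /forallP h2 /forallP h3 /forallP h4 /forallP h5]|].
  split=> [c la_c|c la_c|c1 c2 d f1 f2|c d fc|d mu_d nf|c la_c fr].
  - by have := h1 c; rewrite la_c => /existsP[d /andP[mu_d /eqP fc]]; exists d.
  - by have := h1 c; rewrite la_c => /eqP.
  - by have /forallP/(_ c2)/forallP/(_ d) := h2 c1; rewrite f1 f2 eqxx => /eqP.
  - by have /forallP/(_ d) := h3 c; rewrite fc eqxx => /eqP.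
  - have := h4 d; rewrite mu_d (_ : [forall c, _]) => [/eqP//|].
    by apply/forallP => c; apply/eqP.
  - by have := h5 c; rewrite la_c fr => /eqP.
move=> [h1 h0 h2 h3 h4 h5]; split.
- apply/forallP => c; case: posnP => [/h0->//|/h1[d mu_d fc]].
  by apply/existsP; exists d; rewrite mu_d fc eqxx.
- apply/forallP => c1; apply/forallP => c2; apply/forallP => d.
  by apply/implyP => /andP[/eqP f1 /eqP f2]; rewrite (h2 _ _ _ f1 f2).
- apply/forallP => c; apply/forallP => d; apply/implyP => /eqP fc.
  by rewrite (h3 _ _ fc).
- apply/forallP => d; apply/implyP => /andP[mu_d /forallP nf]; apply/eqP.
  by apply: h4 => // c; apply/eqP.
- by apply/forallP => c; apply/implyP => /andP[la_c fr]; apply/eqP/h5.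
Qed.

Definition is_first la c :=
  (0 < la c)%N /\ forall c', (0 < la c')%N -> c' != c -> processed_before la c c'.

Lemma exists_first la c0 : (0 < la c0)%N -> exists c, is_first la c.
Proof.
move=> la_c0.
(* As c < n, the number la c * n + c orders the balls by label first and by column second. *)
case: (@arg_maxnP _ c0 (fun c => 0 < la c)%N (fun c => la c * n + c)%N la_c0) => c la_c max_c.
exists c; split=> // c' la_c' c'c; have := max_c _ la_c'.
have := ltn_ord c; have := ltn_ord c'; move: c'c; rewrite -val_eqE /processed_before /=.
case: (ltngtP (la c') (la c)) => //= [lt_la _ lt_c'n lt_cn le_c|->]; last by lia.
by have := leq_mul lt_la (leqnn n); rewrite mulSn; lia.
Qed.

Lemma processed_before_irr la c : processed_before la c c = false.
Proof. by rewrite /processed_before !ltnn andbF. Qed.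

Lemma is_first_before la c c' : is_first la c -> processed_before la c' c = false.
Proof.
move=> [la_c first_c]; apply/negP => c'c.
have la_c' : (0 < la c')%N by move: c'c; rewrite /processed_before; lia.
have c'_c : c' != c by apply: contraTneq c'c => ->; rewrite processed_before_irr.
by move: c'c (first_c _ la_c' c'_c); rewrite /processed_before; lia.
Qed.

Definition link_set f c d : {ffun 'I_n -> option 'I_n} :=
  [ffun c' => if c' == c then Some d else f c'].
Definition link_drop f c : {ffun 'I_n -> option 'I_n} :=
  [ffun c' => if c' == c then None else f c'].

Section First.

Variables (la mu : 'I_n -> nat) (f : {ffun 'I_n -> option 'I_n}) (c d : 'I_n).
Hypotheses (first_c : is_first la c) (fc : f c = Some d).

Let la' := zero_at la c.
Let mu' := zero_at mu d.
Let f' := link_drop f c.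

Lemma row_free_first : row_free la mu f c = [set e | (0 < mu e)%N].
Proof.
apply/setP => e; rewrite !inE; case: (0 < mu e)%N => //=.
by apply/forallP => c1; rewrite is_first_before.
Qed.

(** Once c has taken d, the position d is lost to every later ball, just as if it were empty. *)
Lemma row_free_next c' : c' != c -> (0 < la c')%N ->
  row_free la mu f c' = row_free la' mu' f' c'.
Proof.
move=> c'c la_c'; have [la_c before_c] := first_c.
have before' c1 : c1 != c -> processed_before la' c1 c' = processed_before la c1 c'.
  by move=> c1c; rewrite /processed_before /la' /zero_at (negPf c1c) (negPf c'c).
have before'c : processed_before la' c c' = false.
  by rewrite /processed_before /la' /zero_at eqxx (negPf c'c); lia.
apply/setP => e; rewrite !inE; apply/andP/andP => -[mu_e /forallP fr].
  have ed : e != d.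
    by apply: contraTneq (fr c) => ->; rewrite before_c //= fc eqxx.
  split; first by rewrite /mu' /zero_at (negPf ed).
  apply/forallP => c1; case: (eqVneq c1 c) => [->|c1c]; first by rewrite before'c.
  by rewrite before' // ffunE (negPf c1c).
have ed : e != d by move: mu_e; rewrite /mu' /zero_at; case: (e == d).
split; first by move: mu_e; rewrite /mu' /zero_at (negPf ed).
apply/forallP => c1; case: (eqVneq c1 c) => [->|c1c].
  by apply/implyP => _; rewrite fc; apply: contra_neq ed => -[].
by move: (fr c1); rewrite before' // ffunE (negPf c1c).
Qed.

(** For the first ball all lower balls are free, so the trivial rule says d = c whenever position c
    below is occupied. The remaining conditions restrict to the two rows without this pair. *)
Lemma row_matching_first : row_matching la mu f =
  [&& mu d == la c, (0 < mu c)%N ==> (d == c) & row_matching la' mu' f'].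
Proof.
have [la_c before_c] := first_c.
have la'E c' : c' != c -> la' c' = la c' by rewrite /la' /zero_at => /negPf->.
have mu'E e : e != d -> mu' e = mu e by rewrite /mu' /zero_at => /negPf->.
have f'E c' : c' != c -> f' c' = f c' by rewrite /f' ffunE => /negPf->.
have la'c : la' c = 0%N by rewrite /la' /zero_at eqxx.
have mu'd : mu' d = 0%N by rewrite /mu' /zero_at eqxx.
have f'c : f' c = None by rewrite /f' ffunE eqxx.
apply/row_matchingP/and3P => [[h1 h0 h2 h3 h4 h5]|[/eqP mu_d /implyP triv /row_matchingP]].
  split; first by rewrite (h3 _ _ fc).
    apply/implyP => mu_c; have := h5 c la_c; rewrite row_free_first inE => /(_ mu_c).
    by rewrite fc => -[->].
  have f_nd c' : c' != c -> f c' <> Some d.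
    by move=> c'c fc'; case/eqP: c'c; apply: h2 fc.
  apply/row_matchingP; split.
  - move=> c'; case: (eqVneq c' c) => [->|c'c]; first by rewrite la'c.
    rewrite la'E // f'E // => /h1[d' mu_d' fc']; exists d' => //.
    by rewrite mu'E //; apply/eqP => dE; case: (f_nd c' c'c); rewrite -dE.
  - move=> c'; case: (eqVneq c' c) => [->//|c'c]; rewrite la'E // f'E //; exact: h0.
  - move=> c1 c2 e; case: (eqVneq c1 c) => [->|c1c]; first by rewrite f'c.
    case: (eqVneq c2 c) => [->|c2c]; first by rewrite f'c.
    by rewrite !f'E //; exact: h2.
  - move=> c' e; case: (eqVneq c' c) => [->|c'c]; first by rewrite f'c.
    rewrite f'E // la'E // => fc'; rewrite mu'E; first exact: h3.
    by apply/eqP => dE; case: (f_nd c' c'c); rewrite -dE.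
  - move=> e; case: (eqVneq e d) => [->|ed]; first by rewrite mu'd.
    rewrite mu'E // => mu_e nf; apply: h4 => // c'.
    case: (eqVneq c' c) => [->|c'c]; last by rewrite -f'E.
    by rewrite fc => -[de]; case/eqP: ed.
  - move=> c'; case: (eqVneq c' c) => [->|c'c]; first by rewrite la'c.
    by rewrite la'E // f'E // => la_c'; rewrite -row_free_next //; apply: h5.
move=> [h1 h0 h2 h3 h4 h5].
have f_nd c' : c' != c -> f c' <> Some d.
  move=> c'c fc'; have f'c' : f' c' = Some d by rewrite f'E.
  have := h3 _ _ f'c'; rewrite mu'd => la'c'; have := h0 c' (esym la'c').
  by rewrite f'c'.
split.
- move=> c'; case: (eqVneq c' c) => [-> _|c'c la_c'].
    by exists d => //; rewrite mu_d.
  have [|d' mu_d' fc'] := h1 c'; first by rewrite la'E.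
  exists d'; last by rewrite -f'E.
  by move: mu_d'; rewrite /mu' /zero_at; case: eqP.
- move=> c'; case: (eqVneq c' c) => [la_c0|c'c la_c'].
    by move: la_c; rewrite la_c0 => /[swap] ->.
  by rewrite -f'E //; apply: h0; rewrite la'E.
- move=> c1 c2 e; case: (eqVneq c1 c) => [->|c1c].
    rewrite fc => -[<-]; case: (eqVneq c2 c) => [->//|c2c].
    by move/(f_nd _ c2c).
  case: (eqVneq c2 c) => [->|c2c]; last by rewrite -!f'E //; apply: h2.
  by rewrite fc => /[swap] -[<-] /(f_nd _ c1c).
- move=> c' e; case: (eqVneq c' c) => [->|c'c]; first by rewrite fc => -[<-].
  move=> fc'; rewrite -(la'E _ c'c) -(h3 c' e) ?f'E // mu'E //.
  by apply/eqP => dE; case: (f_nd c' c'c); rewrite -dE.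
- move=> e mu_e nf; have ed : e != d by apply/eqP => eE; case: (nf c); rewrite eE.
  rewrite -(mu'E _ ed); apply: h4; first by rewrite mu'E.
  move=> c'; case: (eqVneq c' c) => [->|c'c]; [by rewrite f'c | by rewrite f'E].
- move=> c'; case: (eqVneq c' c) => [->|c'c] la_c'.
    by rewrite row_free_first inE fc => /triv/eqP->.
  rewrite row_free_next // => fr; rewrite -f'E //; apply: h5 => //.
  by rewrite la'E.
Qed.

End First.

End RowMatchings.

Section RowConditions.

Variables (n L rr : nat).
Implicit Types (la mu : 'I_n -> nat) (c d e : 'I_n).

Definition row_ok (b : nat) mu : bool := [forall d, (mu d == 0%N) || (b <= mu d)%N].

(** Labels from rr on reach the lower row only through the matching, hence occur equally often in
    both rows. *)
Definition row_balanced la mu : bool :=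
  [forall j : 'I_L.+1, (rr <= j)%N ==> balanced_at j la mu].

Lemma row_okP b mu : reflect (forall d, mu d = 0%N \/ (b <= mu d)%N) (row_ok b mu).
Proof.
apply: (iffP forallP) => h d; last by case: (h d) => [->|->]; rewrite ?orbT.
by case/orP: (h d) => [/eqP|]; [left|right].
Qed.

Lemma card_zero_at (mu : 'I_n -> nat) d j : (0 < j)%N ->
  #|[set e | mu e == j]| =
  ((mu d == j) + #|[set e | zero_at mu d e == j]|)%N.
Proof.
move=> j_gt0; rewrite (cardsD1 d) inE; congr addn; apply: eq_card => e.
by rewrite !inE /zero_at; case: (e =P d) => //= _; lia.
Qed.

Lemma row_balanced_step la mu c d : (0 < rr)%N -> mu d = la c ->
  row_balanced (zero_at la c) (zero_at mu d) = row_balanced la mu.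
Proof.
move=> rr_gt0 mu_d; apply: eq_forallb => j; case: leqP => //= le_j.
rewrite /balanced_at (@card_zero_at la c) ?(@card_zero_at mu d); [|lia..].
by rewrite mu_d eqn_add2l.
Qed.

Lemma row_ok_step b mu d : (b <= mu d)%N -> row_ok b (zero_at mu d) = row_ok b mu.
Proof.
by move=> le_b; apply: eq_forallb => e; rewrite /zero_at; case: (e =P d) => //= ->; lia.
Qed.

Lemma row_balanced_exists la mu j : row_balanced la mu -> (rr <= j <= L)%N ->
  (exists e, mu e = j) <-> (exists e, la e = j).
Proof.
move=> /forallP/(_ (inord j)) bal /andP[le_j le_L]; move: bal.
rewrite inordK // le_j /= => /eqP bal.
have ex (g : 'I_n -> nat) : (exists e, g e = j) <-> (0 < #|[set e | g e == j]|)%N.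
  split=> [[e ge]|/card_gt0P[e]]; last by rewrite inE => /eqP; exists e.
  by apply/card_gt0P; exists e; rewrite inE ge.
by rewrite !ex bal.
Qed.

End RowConditions.

(** * The sum over matchings as a product over labels *)

Section RowSum.

Variables (k : fieldType) (q t : k) (n L rr : nat).
Hypothesis t_neq0 : t != 0.
Hypothesis qt_neq1 : forall e m, (0 < e)%N -> 1 - q ^+ e * t ^+ m != 0.
Hypothesis rr_gt1 : (1 < rr)%N.
Implicit Types (la mu : 'I_n -> nat) (c d e : 'I_n) (f : {ffun 'I_n -> option 'I_n}).

Definition pair_weight la mu f c d : k :=
  let e := (la c - rr + 1)%N in
  if d == c then 1 else
    (1 - t) * t ^+ #|[set x in row_free la mu f c | (0 < cdist c x < cdist c d)%N]|
      / (1 - q ^+ e * t ^+ #|row_free la mu f c|)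
      * (if (d < c)%N then q ^+ e else 1).

Definition link_weight la mu f : k :=
  \prod_c (if f c is Some d then pair_weight la mu f c d else 1).

Definition row_sum la mu : k :=
  \sum_(f | row_matching rr la mu f) link_weight la mu f.

(** A genuine trace vanishes when bosons are not conserved; the polynomial [lpoly] does not see
    this, hence the explicit guard. *)
Definition row_prod la mu : k :=
  if row_ok rr.-1 mu && row_balanced L rr la mu
  then \prod_(j < L.+1 | (rr <= j)%N) lev t (q ^+ (j - rr + 1)) j la mu else 0.

Definition first_weight la mu c d : k :=
  if d == c then 1 else
    (1 - t) * t ^+ nskip mu c d
      / (1 - q ^+ (la c - rr + 1) * t ^+ #|[set e | (0 < mu e)%N]|)
      * (q ^+ (la c - rr + 1)) ^+ (d < c)%N.

Lemma link_weight_first la mu f c d : is_first la c ->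
  row_matching rr (zero_at la c) (zero_at mu d) f ->
  link_weight la mu (link_set f c d) =
  first_weight la mu c d * link_weight (zero_at la c) (zero_at mu d) f.
Proof.
move=> first_c /row_matchingP[h1 h0 h2 h3 h4 h5].
have sc : link_set f c d c = Some d by rewrite ffunE eqxx.
have f_c : f c = None by apply: h0; rewrite /zero_at eqxx.
have dropK : link_drop (link_set f c d) c = f.
  by apply/ffunP => e; rewrite !ffunE; case: eqP => // ->.
rewrite /link_weight (bigD1 c) //= [in RHS](bigD1 c) //= sc f_c mul1r; congr (_ * _).
  rewrite /pair_weight /first_weight row_free_first //.
  case: eqP => // _; congr (_ * _ ^+ _ / _ * _); last by case: (d < c)%N.
  by apply: eq_card => e; rewrite !inE.
apply: eq_bigr => c' c'c; rewrite ffunE (negPf c'c).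
case fc': (f c') => [d'|] //.
have la_c' : (0 < la c')%N.
  case: (posnP (la c')) => // la0; move: (h0 c'); rewrite fc' /zero_at (negPf c'c).
  by move/(_ la0).
by rewrite /pair_weight (row_free_next mu first_c sc) // dropK /zero_at (negPf c'c).
Qed.

Lemma row_sum_first la mu c : is_first la c ->
  row_sum la mu = \sum_(d | (mu d == la c) && ((0 < mu c)%N ==> (d == c)))
    first_weight la mu c d * row_sum (zero_at la c) (zero_at mu d).
Proof.
move=> first_c.
(* The default c is never taken: in a matching the ball of column c is linked. *)
pose tgt f := odflt c (f c).
rewrite /row_sum (partition_big tgt (fun d => (mu d == la c) && ((0 < mu c)%N ==> (d == c)))) /=.
  apply: eq_bigr => d /andP[mu_d triv]; rewrite big_distrr /=.
  rewrite (reindex_onto (fun f => link_set f c d) (fun f => link_drop f c)) /=.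
    apply: eq_big => [f|f].
      have sc : link_set f c d c = Some d by rewrite ffunE eqxx.
      rewrite (row_matching_first _ _ first_c sc) mu_d triv /tgt sc eqxx andbT /=.
      apply/andP/idP => [[rm /eqP dK]|rm]; first by rewrite dK in rm.
      suff dropK : link_drop (link_set f c d) c = f by rewrite dropK.
      move/row_matchingP: rm => /rm_none/(_ c); rewrite /zero_at eqxx => /(_ erefl) f_c.
      by apply/ffunP => e; rewrite !ffunE; case: eqP => // ->.
    move=> /andP[/andP[rm _] /eqP dK]; rewrite link_weight_first //.
    move: rm; have sc : link_set f c d c = Some d by rewrite ffunE eqxx.
    by rewrite (row_matching_first _ _ first_c sc) dK => /and3P[].
  move=> f /andP[/row_matchingP rm /eqP fc]; apply/ffunP => e; rewrite !ffunE.
  case: eqP => // ->; have [|d' _ fc'] := rm_some rm (c := c); first by case: first_c.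
  by rewrite -fc /tgt fc'.
move=> f rm; have /row_matchingP/rm_some/(_ c) := rm; case: (first_c) => la_c _.
move=> /(_ la_c)[d _ fc]; move: rm; rewrite (row_matching_first _ _ first_c fc).
by rewrite /tgt fc => /and3P[-> ->].
Qed.

(** Nothing is matched, so every lower ball must carry the label rr.-1. For an empty upper row the
    guard of [row_prod] says exactly this, and then every level is 1. *)
Lemma row_sum_empty la mu : (forall c, la c = 0%N) -> (forall c, (mu c <= L)%N) ->
  row_sum la mu = row_prod la mu.
Proof.
move=> la0 mu_L; pose f0 : {ffun 'I_n -> option 'I_n} := [ffun=> None].
have f0c c : f0 c = None by rewrite ffunE.
have rm_f0 f : row_matching rr la mu f -> f = f0.
  by move=> /row_matchingP rm; apply/ffunP => c; rewrite f0c (rm_none rm).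
have bal0 j : (0 < j)%N -> #|[set c | la c == j]| = 0%N.
  by move=> j_gt0; apply: eq_card0 => c; rewrite !inE la0; lia.
have row0 : row_matching rr la mu f0 = row_ok rr.-1 mu && row_balanced L rr la mu.
  apply/row_matchingP/andP => [rm|[/row_okP ok /forallP bal]].
    have muE d : mu d = 0%N \/ mu d = rr.-1.
      case: (posnP (mu d)); [by left | right].
      by apply: (rm_free rm) => // c; rewrite f0c.
    split; first by apply/row_okP => d; case: (muE d) => ->; [left|right].
    apply/forallP => j; apply/implyP => le_j; rewrite /balanced_at bal0; last by lia.
    rewrite eq_sym; by apply/eqP/eq_card0 => d; rewrite !inE; case: (muE d) => ->; lia.
  split=> [c|c|c1 c2 d|c d|d mu_d _|c]; rewrite ?la0 ?f0c //.
  case: (ok d) => [|le_mu]; first by lia.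
  apply/eqP; rewrite eqn_leq le_mu andbT; case: (leqP (mu d) rr.-1) => // lt_mu.
  have := bal (inord (mu d)); rewrite inordK ?ltnS ?mu_L //.
  rewrite (_ : rr <= mu d)%N /balanced_at ?bal0 //; [|lia..].
  rewrite eq_sym cards_eq0 => /eqP/setP/(_ d); by rewrite !inE eqxx.
rewrite /row_sum /row_prod -row0; case: ifP => [rm|nrm]; last first.
  by apply: big_pred0 => f; apply/negP => rm; move: nrm; rewrite -(rm_f0 _ rm) rm.
rewrite (big_pred1 f0) => [|f]; last first.
  by apply/idP/eqP => [/rm_f0|->].
rewrite /link_weight big1 => [|c _]; last by rewrite f0c.
move: rm; rewrite row0 => /andP[_ /forallP bal].
rewrite big1 // => j le_j; rewrite lev_absent //.
- by move=> m; apply: qt_neq1; lia.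
- by move=> c; rewrite la0; lia.
have := bal j; rewrite le_j /balanced_at bal0; last by lia.
rewrite eq_sym cards_eq0 => /eqP/setP muj e.
by have := muj e; rewrite !inE => ->.
Qed.

(** Induction on the number of upper balls, removing the first one. Its label a is the largest in
    the upper row and, by balance, in the lower one: levels above a are 1, and levels below a do not
    see the removed pair. In level a the position below is empty ([lev_insert]), labelled a
    ([lev_trivial]), or smaller, and then both sides vanish ([lev_clash]). *)
Lemma row_sumE la mu : row_ok rr la -> (forall c, (la c <= L)%N) ->
  (forall c, (mu c <= L)%N) -> row_sum la mu = row_prod la mu.
Proof.
move: {2}#|_| (leqnn #|[set c | (0 < la c)%N]|) => m.
elim: m la mu => [|m IHm] la mu; rewrite ?leqn0 => le_m la_ok la_L mu_L.
  apply: row_sum_empty => // c; apply/eqP; rewrite -leqn0 leqNgt.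
  by move: le_m; rewrite cards_eq0 => /eqP/setP/(_ c); rewrite !inE => ->.
case: (pickP (fun c => 0 < la c)%N) => [c0 la_c0|la0]; last first.
  by apply: row_sum_empty => // c; apply/eqP; rewrite -leqn0 leqNgt la0.
have [c first_c] := exists_first la_c0; have [la_c before_c] := first_c.
have le_la c' : (la c' <= la c)%N.
  case: (posnP (la c')) => [->//|la_c']; case: (eqVneq c' c) => [->//|c'c].
  by move: (before_c _ la_c' c'c); rewrite /processed_before; lia.
have rr_la : (rr <= la c)%N by case: (row_okP _ _ la_ok c) => //; lia.
set a := la c in la_c le_la rr_la *.
have IH d : row_sum (zero_at la c) (zero_at mu d) = row_prod (zero_at la c) (zero_at mu d).
  apply: IHm.
  - rewrite -ltnS (leq_trans _ le_m) //; apply: proper_card; apply/properP; split.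
      by apply/subsetP => e; rewrite !inE /zero_at; case: eqP.
    by exists c; rewrite !inE ?la_c // /zero_at eqxx.
  - by rewrite row_ok_step.
  - by move=> e; rewrite /zero_at; case: eqP.
  - by move=> e; rewrite /zero_at; case: eqP.
rewrite (row_sum_first _ first_c) -/a.
under eq_bigr => d _ do rewrite IH.
have condE d : mu d == a -> row_ok rr.-1 (zero_at mu d) &&
    row_balanced L rr (zero_at la c) (zero_at mu d) =
    row_ok rr.-1 mu && row_balanced L rr la mu.
  by move=> /eqP mu_d; rewrite row_ok_step ?row_balanced_step //; lia.
rewrite {2}/row_prod; case: ifP => [cond|ncond]; last first.
  by rewrite big1 // => d /andP[mu_d _]; rewrite /row_prod condE // ncond mulr0.
have {}IH d : mu d == a -> row_prod (zero_at la c) (zero_at mu d) =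
    \prod_(j < L.+1 | (rr <= j)%N)
      lev t (q ^+ (j - rr + 1)) j (zero_at la c) (zero_at mu d).
  by move=> mu_d; rewrite /row_prod condE // cond.
under eq_bigr => d /andP[mu_d _] do rewrite IH //.
case/andP: cond => /row_okP mu_ok bal.
have le_mu e : (mu e <= a)%N.
  rewrite leqNgt; apply/negP => lt_e.
  have le_rr : (rr <= mu e <= L)%N by rewrite mu_L andbT; lia.
  have [/(_ (ex_intro _ e erefl))[e' la_e'] _] := row_balanced_exists bal le_rr.
  by have := le_la e'; lia.
have aL : (a < L.+1)%N by rewrite ltnS la_L.
pose ja := Ordinal aL.
have other d : mu d == a -> \prod_(j < L.+1 | (rr <= j)%N && (j != ja))
      lev t (q ^+ (j - rr + 1)) j (zero_at la c) (zero_at mu d) =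
    \prod_(j < L.+1 | (rr <= j)%N && (j != ja)) lev t (q ^+ (j - rr + 1)) j la mu.
  move=> /eqP mu_d; apply: eq_bigr => j /andP[le_j]; rewrite -val_eqE /= => ja_neq.
  have zt m' : 1 - q ^+ (j - rr + 1) * t ^+ m' != 0 by apply: qt_neq1; lia.
  case: (ltngtP j a) ja_neq => // [lt_ja|lt_aj] _.
    by rewrite -(@lev_lower _ _ _ _ j a) //; lia.
  have absent (g : 'I_n -> nat) e' : (forall e, (g e <= a)%N) ->
      (forall e, g e != j) /\ (forall e, zero_at g e' e != j).
    move=> le_g; have gj e : g e != j by have := le_g e; lia.
    by split=> // e; rewrite /zero_at; case: (e =P e') => // _; lia.
  have [la1 la2] := absent la c le_la; have [mu1 mu2] := absent mu d le_mu.
  by rewrite !lev_absent.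
have zt m' : 1 - q ^+ (a - rr + 1) * t ^+ m' != 0 by apply: qt_neq1; lia.
rewrite [RHS](bigD1 ja) //=.
case: (posnP (mu c)) => [mu_c|mu_c].
  rewrite (lev_insert t_neq0 zt la_c le_mu _ erefl mu_c); last first.
    by have /forallP/(_ ja)/implyP/(_ rr_la) := bal.
  rewrite mulr_suml; apply: eq_big => [d|d]; first by rewrite andbT.
  rewrite andbT => mu_d; rewrite (bigD1 ja) //= other // mulrA; congr (_ * _ * _).
  rewrite /first_weight -/a; case: (d =P c) => // dc.
  by move: mu_d; rewrite dc mu_c; lia.
rewrite (eq_bigl (fun d => (d == c) && (mu d == a))) => [|d]; last first.
  by rewrite /= andbC.
rewrite big_mkcondr big_pred1_eq; case: (mu c =P a) => [mu_ca|mu_ca]; last first.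
  by rewrite (@lev_clash _ _ _ _ a la mu c) ?mul0r //; have := le_mu c; lia.
rewrite /first_weight eqxx mul1r (bigD1 ja) //= other ?mu_ca //; congr (_ * _).
by rewrite -lev_trivial.
Qed.

End RowSum.

(** * Exchange relations *)

Section LocalExchange.

Variables (k : fieldType) (t : k).

(* Two adjacent sites with top labels A, B and bottom labels a, b; w is t^-1
   times the value of t^height before the first site, to avoid inverses. *)
Definition loc j A a B b (w : k) : {poly k} :=
  cfac j A a (w * t) *
  cfac j B b (w * (if A == j then (if a == j then t else t * t)
                   else if a == j then 1 else t)).

Variables (L rr : nat) (phi : 'I_L.+1 -> {poly k} -> k) (w : 'I_L.+1 -> k).
Hypothesis phiD : forall j f g, phi j (f + g) = phi j f + phi j g.
Hypothesis phiZ : forall j x f, phi j (x *: f) = x * phi j f.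

(** [phi j] stands for the trace of level j over all other sites. Its linearity suffices, so the
    exchange relations reduce to polynomial identities at two sites. *)
Definition locprod A a B b : k :=
  \prod_(j < L.+1 | (rr <= j)%N) phi j (loc j A a B b (w j)).

Lemma locprod_eq A a B b A' a' B' b' :
  (forall j : 'I_L.+1, (rr <= j)%N ->
     loc j A a B b (w j) = loc j A' a' B' b' (w j)) ->
  locprod A a B b = locprod A' a' B' b'.
Proof. by move=> h; apply: eq_bigr => j le_j; rewrite h. Qed.

Lemma locprod0 A a B b x : (rr <= x <= L)%N ->
  (forall u, loc x A a B b u = 0) -> locprod A a B b = 0.
Proof.
move=> /andP[le_x le_L] h; rewrite /locprod (bigD1 (inord x)) /= ?inordK //.
by rewrite h (_ : phi _ 0 = 0) ?mul0r //; rewrite -(scale0r (0 : {poly k})) phiZ mul0r.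
Qed.

Lemma locprod_at x A a B b : (rr <= x <= L)%N ->
  locprod A a B b = phi (inord x) (loc x A a B b (w (inord x))) *
  \prod_(j < L.+1 | (rr <= j)%N && (j != inord x)) phi j (loc j A a B b (w j)).
Proof.
by move=> /andP[le_x le_L]; rewrite /locprod (bigD1 (inord x)) /= ?inordK.
Qed.

Lemma locprod_at2 x y A a B b : (rr <= x <= L)%N -> (rr <= y <= L)%N -> y != x ->
  locprod A a B b = phi (inord x) (loc x A a B b (w (inord x))) *
  (phi (inord y) (loc y A a B b (w (inord y))) *
   \prod_(j < L.+1 | [&& (rr <= j)%N, j != inord x & j != inord y])
     phi j (loc j A a B b (w j))).
Proof.
move=> x_range /andP[le_y le_L] yx; case/andP: (x_range) => _ le_x.
rewrite (locprod_at _ _ _ _ x_range) (bigD1 (inord y)) /=; last first.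
  by rewrite inordK // le_y -val_eqE /= !inordK.
rewrite inordK //; congr (_ * (_ * _)).
by apply: eq_bigl => j; rewrite andbA.
Qed.

Lemma inord_neq x (j : 'I_L.+1) : (x <= L)%N -> j != inord x -> (j != x :> nat).
Proof. by move=> le_x; rewrite -val_eqE /= inordK. Qed.

Lemma locprod_scale x y A a B b A' a' B' b' : (rr <= x <= L)%N ->
  (forall u, loc x A a B b u = y *: loc x A' a' B' b' u) ->
  (forall j : nat, (rr <= j)%N -> j != x -> forall u,
     loc j A a B b u = loc j A' a' B' b' u) ->
  locprod A a B b = y * locprod A' a' B' b'.
Proof.
move=> le_x hx hj; rewrite !(locprod_at _ _ _ _ le_x) hx phiZ -mulrA.
congr (_ * (_ * _)); apply: eq_bigr => j /andP[le_j /inord_neq jx].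
by rewrite hj //; apply: jx; case/andP: le_x.
Qed.

Local Ltac level j x := case: (x =P j) => ?; try (exfalso; lia).
Local Ltac under_level j x := case: (boolP (0 < x < j)%N) => ?; try (exfalso; lia).
Local Ltac loc_tac j A a B b :=
  rewrite /loc /cfac; level j A; level j B; level j a; level j b;
  under_level j a; under_level j b;
  rewrite -?mul_polyC ?rmorphM ?rmorphB ?rmorph1 /=; ring.

Section TwoTops.

Variables (A B : nat).
Hypotheses (rr_gt0 : (0 < rr)%N) (lt_BA : (B < A)%N) (A_range : (rr <= A <= L)%N).

(** The cases place A relative to b < a. Either the levels other than a and A give common factors,
    or products vanish because A stands above a smaller positive label. *)
Lemma exchange_pos a b : (0 < b < a)%N -> (rr <= a <= L)%N ->
  locprod A b B a = t * locprod B a A b /\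
  locprod B b A a = locprod A a B b + (t - 1) * locprod B a A b.
Proof.
move=> ba a_range.
case: (ltngtP A a) => [lt_Aa|lt_aA|eq_Aa].
- case: (ltngtP A b) => [lt_Ab|lt_bA|eq_Ab].
  + have E1 : locprod A b B a = t * locprod B a A b.
      apply: (locprod_scale (x := a)) => // [u|j le_j ja u]; last by loc_tac j A a B b.
      by loc_tac a A a B b.
    have E2 : locprod B b A a = t * locprod B a A b.
      apply: (locprod_scale (x := a)) => // [u|j le_j ja u]; last by loc_tac j A a B b.
      by loc_tac a A a B b.
    have E3 : locprod A a B b = locprod B a A b.
      by apply: locprod_eq => j le_j; loc_tac j A a B b.
    by rewrite E1 E2 E3; split=> //; ring.
  + have E1 : locprod A b B a = 0.
      by apply: (locprod0 (x := A)) => // u; loc_tac A A a B b.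
    have E2 : locprod B a A b = 0.
      by apply: (locprod0 (x := A)) => // u; loc_tac A A a B b.
    rewrite E1 E2 !mulr0 addr0; split=> //.
    have Aa : A != a by lia.
    rewrite !(locprod_at2 _ _ _ _ a_range A_range Aa).
    (* The factor t gained in level a cancels the one lost in level A. *)
    have -> : loc a B b A a (w (inord a)) = t *: loc a A a B b (w (inord a)).
      by move: (w _) => u; loc_tac a A a B b.
    have -> : loc A A a B b (w (inord A)) = t *: loc A B b A a (w (inord A)).
      by move: (w _) => u; loc_tac A A a B b.
    rewrite !phiZ !mulrA; congr (_ * _); first by ring.
    apply: eq_bigr => j /and3P[le_j /inord_neq ja /inord_neq jA].
    have {}ja := ja ltac:(lia); have {}jA := jA ltac:(lia).
    by congr (phi _ _); loc_tac j A a B b.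
  + have E1 : locprod A b B a = t * locprod B a A b.
      apply: (locprod_scale (x := a)) => // [u|j le_j ja u]; last by loc_tac j A a B b.
      by loc_tac a A a B b.
    split=> //.
    have Aa : A != a by lia.
    rewrite !(locprod_at2 _ _ _ _ a_range A_range Aa).
    have -> : loc a B b A a (w (inord a)) = t *: loc a A a B b (w (inord a)).
      by move: (w _) => u; loc_tac a A a B b.
    have -> : loc a B a A b (w (inord a)) = loc a A a B b (w (inord a)).
      by move: (w _) => u; loc_tac a A a B b.
    (* With A = b, creating at the first site and annihilating at the second is compared with the
       reverse order: this is the boson relation a a^+ = t a^+ a + (1 - t). *)
    have E4 : t * phi (inord A) (loc A B b A a (w (inord A))) =
        phi (inord A) (loc A A a B b (w (inord A))) +
        (t - 1) * phi (inord A) (loc A B a A b (w (inord A))).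
      by rewrite -!phiZ -phiD; congr phi; move: (w _) => u; loc_tac A A a B b.
    rewrite !phiZ.
    have R1 : \prod_(j < L.+1 | [&& (rr <= j)%N, j != inord a & j != inord A])
           phi j (loc j A a B b (w j)) =
         \prod_(j < L.+1 | [&& (rr <= j)%N, j != inord a & j != inord A])
           phi j (loc j B a A b (w j)).
      apply: eq_bigr => j /and3P[le_j /inord_neq ja /inord_neq jA].
      have {}ja := ja ltac:(lia); have {}jA := jA ltac:(lia).
      by congr (phi _ _); loc_tac j A a B b.
    have R2 : \prod_(j < L.+1 | [&& (rr <= j)%N, j != inord a & j != inord A])
           phi j (loc j B b A a (w j)) =
         \prod_(j < L.+1 | [&& (rr <= j)%N, j != inord a & j != inord A])
           phi j (loc j B a A b (w j)).
      apply: eq_bigr => j /and3P[le_j /inord_neq ja /inord_neq jA].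
      have {}ja := ja ltac:(lia); have {}jA := jA ltac:(lia).
      by congr (phi _ _); loc_tac j A a B b.
    rewrite R1 R2.
    move: E4; set x := phi (inord A) _; set y := phi (inord A) _; set y' := phi (inord A) _.
    set X := phi (inord a) _; set R := \prod_(_ < _ | _) _ => E4.
    transitivity (X * (t * x) * R); first by ring.
    by rewrite E4; ring.
- have E1 : locprod A b B a = 0.
    by apply: (locprod0 (x := A)) => // u; loc_tac A A a B b.
  have E2 : locprod B a A b = 0.
    by apply: (locprod0 (x := A)) => // u; loc_tac A A a B b.
  have E3 : locprod B b A a = 0.
    by apply: (locprod0 (x := A)) => // u; loc_tac A A a B b.
  have E4 : locprod A a B b = 0.
    by apply: (locprod0 (x := A)) => // u; loc_tac A A a B b.
  by rewrite E1 E2 E3 E4 !mulr0 addr0.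
- have E1 : locprod A b B a = 0.
    by apply: (locprod0 (x := A)) => // u; loc_tac A A a B b.
  have E2 : locprod B a A b = 0.
    by apply: (locprod0 (x := A)) => // u; loc_tac A A a B b.
  rewrite E1 E2 !mulr0 addr0; split=> //.
  by apply: locprod_eq => j le_j; loc_tac j A a B b.
Qed.

Lemma exchange_zero a : (0 < a <= L)%N ->
  locprod A a B 0 = locprod B 0 A a /\
  locprod A 0 B a = t * locprod B a A 0 + (1 - t) * locprod A a B 0.
Proof.
move=> a_gt0; pose z := 0%N.
case: (ltngtP A a) => [lt_Aa|lt_aA|eq_Aa].
- have E1 : locprod A a B 0 = locprod B 0 A a.
    by apply: locprod_eq => j le_j; loc_tac j A a B z.
  have E2 : locprod A 0 B a = locprod B 0 A a.
    by apply: locprod_eq => j le_j; loc_tac j A a B z.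
  have E3 : locprod B a A 0 = locprod B 0 A a.
    by apply: locprod_eq => j le_j; loc_tac j A a B z.
  by rewrite E1 E2 E3; split=> //; ring.
- have E1 : locprod A a B 0 = 0.
    by apply: (locprod0 (x := A)) => // u; loc_tac A A a B z.
  have E2 : locprod B 0 A a = 0.
    by apply: (locprod0 (x := A)) => // u; loc_tac A A a B z.
  rewrite E1 E2 mulr0 addr0; split=> //.
  apply: (locprod_scale (x := A)) => // [u|j le_j ja u]; last by loc_tac j A a B z.
  by loc_tac A A a B z.
have E1 : locprod A a B 0 = locprod B 0 A a.
  by apply: locprod_eq => j le_j; loc_tac j A a B z.
split=> //; rewrite !(locprod_at _ _ _ _ A_range).
have R1 : \prod_(j < L.+1 | (rr <= j)%N && (j != inord A)) phi j (loc j A 0 B a (w j))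
  = \prod_(j < L.+1 | (rr <= j)%N && (j != inord A)) phi j (loc j A a B 0 (w j)).
  apply: eq_bigr => j /andP[le_j /inord_neq jA]; have {}jA := jA ltac:(lia).
  by congr (phi _ _); loc_tac j A a B z.
have R2 : \prod_(j < L.+1 | (rr <= j)%N && (j != inord A)) phi j (loc j B a A 0 (w j))
  = \prod_(j < L.+1 | (rr <= j)%N && (j != inord A)) phi j (loc j A a B 0 (w j)).
  apply: eq_bigr => j /andP[le_j /inord_neq jA]; have {}jA := jA ltac:(lia).
  by congr (phi _ _); loc_tac j A a B z.
(* With A = a, level A is again the boson relation 1 - t^2 wX = t (1 - twX) + (1 - t). *)
rewrite R1 R2 !mulrA -mulrDl -!phiZ -phiD; congr (phi _ _ * _).
by move: (w _) => u; loc_tac A A a B z.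
Qed.

Lemma exchange_eq a : (a <= L)%N -> locprod A a B a = locprod B a A a.
Proof. by move=> a_L; apply: locprod_eq => j le_j; loc_tac j A a B a. Qed.

End TwoTops.

Lemma exchange_same_pos A a b : (0 < rr)%N -> (A = 0%N \/ (rr <= A <= L)%N) ->
  (0 < b < a)%N -> (rr <= a <= L)%N ->
  locprod A b A a = t * locprod A a A b.
Proof.
move=> rr_gt0 A_range ba a_range; case: (ltnP A a) => [lt_Aa|le_aA].
  apply: (locprod_scale (x := a)) => // [u|j le_j ja u]; last by loc_tac j A a A b.
  by loc_tac a A a A b.
have {}A_range : (rr <= A <= L)%N by lia.
have E1 : locprod A b A a = 0.
  by apply: (locprod0 (x := A)) => // u; loc_tac A A a A b.
have E2 : locprod A a A b = 0.
  by apply: (locprod0 (x := A)) => // u; loc_tac A A a A b.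
by rewrite E1 E2 mulr0.
Qed.

Lemma exchange_same_zero A a : (0 < rr)%N -> locprod A 0 A a = locprod A a A 0.
Proof.
by move=> rr_gt0; pose z := 0%N; apply: locprod_eq => j le_j; loc_tac j A a A z.
Qed.

End LocalExchange.

(** * Swapping and rotating columns *)

Section SwapHeights.

Variables (n : nat) (i : 'I_n).
Implicit Types (la mu : 'I_n.+1 -> nat) (l : nat).

Lemma val_pos2 : pos2 i = i.+1 :> nat.
Proof. by rewrite /pos2 lift0. Qed.

Lemma pos12_neq : pos1 i != pos2 i.
Proof. by rewrite -val_eqE /= /bump leq0n add1n neq_ltn ltnSn. Qed.

Lemma swap_comp1 la : swap_comp i la (pos1 i) = la (pos2 i).
Proof. by rewrite /swap_comp tpermL. Qed.

Lemma swap_comp2 la : swap_comp i la (pos2 i) = la (pos1 i).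
Proof. by rewrite /swap_comp tpermR. Qed.

Lemma swap_compD la c : c != pos1 i -> c != pos2 i -> swap_comp i la c = la c.
Proof. by move=> c1 c2; rewrite /swap_comp tpermD // eq_sym. Qed.

(** Only the prefix ending between the two swapped columns is not preserved by the swap. *)
Lemma sum_swap (V : nmodType) (G : 'I_n.+1 -> V) j : j != i.+1 ->
  \sum_(c < n.+1 | (c < j)%N) G (s i c) = \sum_(c < n.+1 | (c < j)%N) G c.
Proof.
move=> ji; rewrite [RHS](reindex_inj (@perm_inj _ (s i))) /=.
apply: eq_bigl => c; rewrite /s; case: tpermP => [->|->|//]; rewrite val_pos2 /=; lia.
Qed.

Lemma hgt_swap_top l la mu j : j != i.+1 ->
  hgt l (swap_comp i la) mu j = hgt l la mu j.
Proof.
move=> ji; rewrite /hgt !sumrB; congr (_ - _).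
exact: (sum_swap (fun c => (la c == l)%:Z)).
Qed.

Lemma hgt_swap_bot l la mu j : j != i.+1 ->
  hgt l la (swap_comp i mu) j = hgt l la mu j.
Proof.
move=> ji; rewrite /hgt !sumrB; congr (_ - _).
exact: (sum_swap (fun c => (mu c == l)%:Z)).
Qed.

Lemma card_swap (P : pred nat) mu :
  #|[set e | P (swap_comp i mu e)]| = #|[set e | P (mu e)]|.
Proof.
by rewrite -!sum1dep_card [RHS](reindex_inj (@perm_inj _ (s i))).
Qed.

Lemma row_ok_swap b mu : row_ok b (swap_comp i mu) = row_ok b mu.
Proof.
apply/forallP/forallP => h d; last exact: h.
by have := h (s i d); rewrite /swap_comp tpermK.
Qed.

Lemma row_balanced_swap_top L rr la mu :
  row_balanced L rr (swap_comp i la) mu = row_balanced L rr la mu.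
Proof.
by apply: eq_forallb => j; rewrite /balanced_at (card_swap (pred1 (j : nat))).
Qed.

Lemma row_balanced_swap_bot L rr la mu :
  row_balanced L rr la (swap_comp i mu) = row_balanced L rr la mu.
Proof.
by apply: eq_forallb => j; rewrite /balanced_at (card_swap (pred1 (j : nat))).
Qed.

End SwapHeights.

Section RotHeights.

Variable n : nat.
Implicit Types (la mu : 'I_n.+1 -> nat) (l : nat).

Lemma ord_pred0 : ord_pred (ord0 : 'I_n.+1) = ord_max.
Proof. by apply: val_inj; rewrite /= modn_small. Qed.

Lemma ord_pred_lift (c : 'I_n) : ord_pred (lift ord0 c) = widen_ord (leqnSn n) c.
Proof.
apply: val_inj; rewrite [LHS]/= add0n.
by rewrite modnDr modn_small // ltnS ltnW.
Qed.

Lemma ord_pred_inj : injective (@ord_pred n.+1).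
Proof. exact: (can_inj (@ord_predK _)). Qed.

Lemma card_rot (P : pred nat) mu :
  #|[set e | P (rot_comp mu e)]| = #|[set e | P (mu e)]|.
Proof.
by rewrite -!sum1dep_card [RHS](reindex_inj ord_pred_inj).
Qed.

Lemma row_ok_rot b mu : row_ok b (rot_comp mu) = row_ok b mu.
Proof.
apply/forallP/forallP => h d; last exact: h.
by have := h (ordS d); rewrite /rot_comp ordSK.
Qed.

Lemma row_balanced_rot L rr la mu :
  row_balanced L rr (rot_comp la) (rot_comp mu) = row_balanced L rr la mu.
Proof.
by apply: eq_forallb => j; rewrite /balanced_at !(card_rot (pred1 (j : nat))).
Qed.

Lemma hgt_rot l la mu (c : 'I_n) : hgt l (rot_comp la) (rot_comp mu) (lift ord0 c) =
  hgt l la mu c + ((la ord_max == l)%:Z - (mu ord_max == l)%:Z).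
Proof.
rewrite /hgt big_mkcond big_ord_recl [in RHS]big_mkcond big_ord_recr /=.
rewrite /rot_comp ord_pred0 ltnNge ltnW //= addr0 addrC; congr (_ + _).
apply: eq_bigr => c' _; rewrite ord_pred_lift /bump !leq0n !add1n ltnS.
by [].
Qed.

End RotHeights.

Section LevelSymmetries.

Variables (k : fieldType) (t : k) (n : nat).
Hypothesis t_neq0 : t != 0.
Implicit Types (la mu : 'I_n.+1 -> nat) (l : nat).

Definition away_poly (i : 'I_n) l la mu : {poly k} :=
  \prod_(c < n.+1 | (c != pos1 i) && (c != pos2 i))
     cfac l (la c) (mu c) (t ^ hgt l la mu c).

Lemma away_poly_swap_top i l la mu :
  away_poly i l (swap_comp i la) mu = away_poly i l la mu.
Proof.
by apply: eq_bigr => c /andP[c1 c2]; rewrite swap_compD // hgt_swap_top //.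
Qed.

Lemma away_poly_swap_bot i l la mu :
  away_poly i l la (swap_comp i mu) = away_poly i l la mu.
Proof.
by apply: eq_bigr => c /andP[c1 c2]; rewrite swap_compD // hgt_swap_bot //.
Qed.

Lemma lpoly_loc i l la mu : lpoly t l la mu =
  loc t l (la (pos1 i)) (mu (pos1 i)) (la (pos2 i)) (mu (pos2 i))
    (t ^ hgt l la mu i / t) * away_poly i l la mu.
Proof.
rewrite /lpoly (bigD1 (pos1 i)) //= (bigD1 (pos2 i)) //=; last first.
  by rewrite eq_sym pos12_neq.
rewrite mulrA /loc divfK //; congr (_ * cfac _ _ _ _ * _).
rewrite (hgtS l la mu (pos1 i)) expfzDr // -mulrA; congr (_ * _).
by do 2!case: eqP => _ /=; rewrite ?expr0z ?expr1z ?exprN1 ?mulr1 ?mulVf ?mulKf.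
Qed.

Lemma lpoly_rot_eq l la mu : hgt l la mu n.+1 = 0 ->
  (la ord_max == l) = (mu ord_max == l) ->
  lpoly t l (rot_comp la) (rot_comp mu) = lpoly t l la mu.
Proof.
move=> h0 eq_max; rewrite /lpoly big_ord_recl [RHS]big_ord_recr /= mulrC.
have := hgtS l la mu ord_max; rewrite h0 eq_max subrr addr0 => /esym/= hn.
rewrite hgt0 hn /rot_comp ord_pred0; congr (_ * _); apply: eq_bigr => c _.
by rewrite ord_pred_lift (hgt_rot l la mu c) eq_max subrr addr0.
Qed.

(** Moved to the front, the creation operator of the last site gives all other sites one more boson,
    which is the substitution of tX for X. *)
Lemma lpoly_rot_up l la mu :
  la ord_max = l -> mu ord_max <> l ->
  lpoly t l (rot_comp la) (rot_comp mu) = lpoly t l la mu \Po (t *: 'X).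
Proof.
move=> la_m /eqP/negPf mu_m; rewrite /lpoly big_ord_recl [in RHS]big_ord_recr /=.
rewrite rmorphM /= mulrC rmorph_prod; congr (_ * _).
  apply: eq_bigr => c _; rewrite /rot_comp ord_pred_lift (hgt_rot l la mu c).
  by rewrite la_m eqxx mu_m subr0 expfzDr // expr1z cfac_comp.
by rewrite -cfac_comp /cfac /rot_comp ord_pred0 la_m eqxx.
Qed.

Lemma lpoly_rot_down l la mu : hgt l la mu n.+1 = 0 ->
  la ord_max <> l -> mu ord_max = l ->
  lpoly t l la mu = lpoly t l (rot_comp la) (rot_comp mu) \Po (t *: 'X).
Proof.
move=> h0 /eqP/negPf la_m mu_m; rewrite /lpoly big_ord_recr [in RHS]big_ord_recl /=.
have := hgtS l la mu ord_max; rewrite h0 la_m mu_m eqxx => hn.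
have {}hn : hgt l la mu n = 1 by move: hn => /=; lia.
rewrite rmorphM /= mulrC rmorph_prod; congr (_ * _).
  by rewrite -cfac_comp hn hgt0 expr0z mul1r expr1z /rot_comp ord_pred0 mu_m.
apply: eq_bigr => c _; rewrite /rot_comp ord_pred_lift (hgt_rot l la mu c).
rewrite la_m mu_m eqxx /= -cfac_comp; congr (cfac _ _ _ _).
by rewrite -[X in _ * X]expr1z -expfzDr //; congr (_ ^ _); lia.
Qed.

(** Carrying the last site to the front shifts the starting level when that site creates or
    annihilates. [tau_shift] turns the shift into a factor z; its boundary term vanishes because an
    annihilation operator meets the vacuum. *)
Lemma lev_rot z l la mu : (forall m, 1 - z * t ^+ m != 0) ->
  balanced_at l la mu ->
  lev t z l (rot_comp la) (rot_comp mu) * z ^+ (la ord_max == l) =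
  lev t z l la mu * z ^+ (mu ord_max == l).
Proof.
move=> zt bal; have h0 : hgt l la mu n.+1 = 0 by rewrite hgt_full (eqP bal) subrr.
rewrite /lev (card_rot (fun x => 0 < x < l)%N) -!mulrA; congr (_ * _).
case: (la ord_max =P l) => la_m; case: (mu ord_max =P l) => mu_m /=.
- by rewrite lpoly_rot_eq // la_m mu_m.
- rewrite lpoly_rot_up // mulrC expr1 tau_shift // (@lpoly_root1 _ _ _ _ _ _ n) ?subr0 ?mulr1 //.
  have := hgtS l la mu ord_max; rewrite h0 la_m eqxx (introF eqP mu_m) /=; lia.
- rewrite [in RHS]lpoly_rot_down // mulr1 [RHS]mulrC expr1 tau_shift //.
  rewrite [X in _ - X](_ : _ = 0) ?subr0 //.
  rewrite /lpoly big_ord_recl hornerM hgt0 expr0z /rot_comp ord_pred0 mu_m.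
  by rewrite /cfac eqxx (introF eqP la_m) !hornerE subrr mul0r.
- by rewrite lpoly_rot_eq // (introF eqP la_m) (introF eqP mu_m).
Qed.

End LevelSymmetries.

(** * Symmetries of the transition coefficients between two rows *)

Section RowSymmetries.

Variables (k : fieldType) (q t : k) (n L rr : nat).
Hypothesis t_neq0 : t != 0.
Hypothesis qt_neq1 : forall e m, (0 < e)%N -> 1 - q ^+ e * t ^+ m != 0.
Hypothesis rr_gt1 : (1 < rr)%N.
Implicit Types (la mu : 'I_n.+1 -> nat).
Local Notation row_prod := (row_prod q t L rr).

Section Exchange.

Variable i : 'I_n.
Local Notation sw := (swap_comp i).
Local Notation p1 := (pos1 i).
Local Notation p2 := (pos2 i).

Definition row_phi la mu (j : 'I_L.+1) (f : {poly k}) : k :=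
  let z := q ^+ (j - rr + 1) in
  (1 - z * t ^+ #|[set e | (0 < mu e < j)%N]|) *
  tau t z (f * away_poly t i j la mu).

Lemma row_phiD la mu j f g : row_phi la mu j (f + g) = row_phi la mu j f + row_phi la mu j g.
Proof. by rewrite /row_phi [(f + g) * _]mulrDl tauD mulrDr. Qed.

Lemma row_phiZ la mu j x f : row_phi la mu j (x *: f) = x * row_phi la mu j f.
Proof. by rewrite /row_phi -scalerAl tauZ mulrCA. Qed.

Definition row_w la mu (j : 'I_L.+1) : k := t ^ hgt j la mu i / t.

Definition row_cond la mu := row_ok rr.-1 mu && row_balanced L rr la mu.

(** The surroundings of the two sites are kept apart from their four labels. Swaps of either row
    leave the surroundings unchanged, so all terms of an exchange relation share them. *)
Definition row_loc la mu A a B b : k :=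
  if row_cond la mu then
    locprod t rr (row_phi la mu) (row_w la mu) A a B b
  else 0.

Lemma row_prod_loc la mu :
  row_prod la mu = row_loc la mu (la p1) (mu p1) (la p2) (mu p2).
Proof.
rewrite /row_prod /row_loc /row_cond; case: ifP => // _; apply: eq_bigr => j _.
by rewrite /row_phi /lev (lpoly_loc t_neq0 i).
Qed.

Lemma row_loc_swap_top la mu A a B b : row_loc (sw la) mu A a B b = row_loc la mu A a B b.
Proof.
rewrite /row_loc /row_cond row_balanced_swap_top; case: ifP => // _; apply: eq_bigr => j _.
by rewrite /row_phi /row_w away_poly_swap_top hgt_swap_top // neq_ltn ltnSn.
Qed.

Lemma row_loc_swap_bot la mu A a B b : row_loc la (sw mu) A a B b = row_loc la mu A a B b.
Proof.
rewrite /row_loc /row_cond row_balanced_swap_bot row_ok_swap; case: ifP => // _.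
apply: eq_bigr => j _; rewrite /row_phi /row_w away_poly_swap_bot hgt_swap_bot ?neq_ltn ?ltnSn //.
by rewrite (card_swap i (fun x => 0 < x < j)%N).
Qed.

(* The coefficient of F_la in T_i (sum_la (row_prod la mu) F_la). *)
Definition hecke_coef la mu : k :=
  if la p1 == la p2 then t * row_prod la mu
  else if (la p2 < la p1)%N then t * row_prod (sw la) mu
  else row_prod (sw la) mu + (t - 1) * row_prod la mu.

Variables (la mu : 'I_n.+1 -> nat).
Hypotheses (la_ok : row_ok rr la) (la_L : forall c, (la c <= L)%N).
Hypothesis (mu_L : forall c, (mu c <= L)%N).

Lemma la_range c x : (x < la c)%N -> (rr <= la c <= L)%N.
Proof. by move=> la_c; rewrite la_L andbT; case: (row_okP _ _ la_ok c) => //; lia. Qed.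

Lemma row_prod_swap_pos : (0 < mu p2 < mu p1)%N ->
  row_prod la (sw mu) = hecke_coef la mu.
Proof.
move=> ba; rewrite /hecke_coef !row_prod_loc !row_loc_swap_top ?row_loc_swap_bot
  ?swap_comp1 ?swap_comp2 /row_loc; case: ifP => [|_]; last first.
  by rewrite !mulr0 addr0 !if_same.
case/andP=> /row_okP mu_ok _.
have a_range : (rr <= mu p1 <= L)%N.
  by rewrite mu_L andbT; case: (mu_ok p2); lia.
have rr_gt0 : (0 < rr)%N by lia.
case: (ltngtP (la p1) (la p2)) => [lt_la|lt_la|eq_la].
- have [_ ->] := exchange_pos t (row_w la mu) (row_phiD la mu) (row_phiZ la mu)
    rr_gt0 lt_la (la_range lt_la) ba a_range.
  by [].
- have [-> _] := exchange_pos t (row_w la mu) (row_phiD la mu) (row_phiZ la mu)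
    rr_gt0 lt_la (la_range lt_la) ba a_range.
  by [].
- rewrite -eq_la; apply: (exchange_same_pos t (row_w la mu) (row_phiZ la mu)) => //.
  by case: (posnP (la p1)) => [|/la_range]; [left|right].
Qed.

(** The term with 1 - t is the one that arises when T_i passes x_i in the row monomial, as in
    [hecke_mul_X]. *)
Lemma row_prod_swap_zero : mu p2 = 0%N -> (0 < mu p1)%N ->
  row_prod la (sw mu) = hecke_coef la mu + (1 - t) * row_prod la mu.
Proof.
move=> b0 a_gt0; rewrite /hecke_coef !row_prod_loc !row_loc_swap_top ?row_loc_swap_bot
  ?swap_comp1 ?swap_comp2 b0 /row_loc; case: ifP => [cond|_]; last first.
  by rewrite !mulr0 !addr0 !if_same ?addr0.
have a_range : (0 < mu p1 <= L)%N by rewrite mu_L andbT.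
have rr_gt0 : (0 < rr)%N by lia.
case: (ltngtP (la p1) (la p2)) => [lt_la|lt_la|eq_la].
- have [-> _] := exchange_zero t (row_w la mu) (row_phiD la mu) (row_phiZ la mu)
    rr_gt0 lt_la (la_range lt_la) a_range.
  by ring.
- have [_ ->] := exchange_zero t (row_w la mu) (row_phiD la mu) (row_phiZ la mu)
    rr_gt0 lt_la (la_range lt_la) a_range.
  by [].
- by rewrite -eq_la exchange_same_zero //; ring.
Qed.

Lemma hecke_coef_eq : mu p1 = mu p2 -> hecke_coef la mu = t * row_prod la mu.
Proof.
move=> ab; rewrite /hecke_coef !row_prod_loc !row_loc_swap_top ?row_loc_swap_bot
  ?swap_comp1 ?swap_comp2 ab /row_loc; case: (row_cond la mu); last first.
  by rewrite !mulr0 !addr0 !if_same ?addr0.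
have rr_gt0 : (0 < rr)%N by lia.
case: (ltngtP (la p1) (la p2)) => [lt_la|lt_la|//].
  by rewrite (exchange_eq _ _ _ rr_gt0 lt_la (la_range lt_la)) //; ring.
by rewrite (exchange_eq _ _ _ rr_gt0 lt_la (la_range lt_la)).
Qed.

End Exchange.

(** Only the level j = x contributes; for x < rr there is none, and the truncated exponent is 0. *)
Lemma level_power_prod x : (x <= L)%N ->
  \prod_(j < L.+1 | (rr <= j)%N) (q ^+ (j - rr + 1)) ^+ (x == j)
  = q ^+ (x - rr.-1).
Proof.
move=> le_x; case: (leqP rr x) => [le_rr|lt_rr].
  rewrite (bigD1 (inord x)) /= ?inordK // eqxx big1 ?mulr1 => [|j /andP[_]].
    by rewrite expr1; congr (_ ^+ _); lia.
  by rewrite -val_eqE /= inordK // eq_sym => /negPf->.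
rewrite big1 => [|j le_j]; last by rewrite (ltn_eqF (leq_trans lt_rr le_j)).
by rewrite (_ : x - rr.-1 = 0)%N //; lia.
Qed.

Lemma row_prod_rot la mu : (forall c, (la c <= L)%N) -> (forall c, (mu c <= L)%N) ->
  row_prod (rot_comp la) (rot_comp mu) * q ^+ (la ord_max - rr.-1) =
  row_prod la mu * q ^+ (mu ord_max - rr.-1).
Proof.
move=> la_L mu_L; rewrite /row_prod row_ok_rot row_balanced_rot.
case: ifP => [/andP[_ /forallP bal]|_]; last by rewrite !mul0r.
rewrite -!level_power_prod // -!big_split /=; apply: eq_bigr => j le_j.
apply: lev_rot => //; last by apply: (implyP (bal j)).
by move=> m; apply: qt_neq1; lia.
Qed.

End RowSymmetries.

(** * Hecke operators and the induction on rows *)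

Section HeckeRelation.

Variables (k : fieldType) (t : k) (n : nat) (i : 'I_n).
Local Notation R := {mpoly k[n.+1]}.
Local Notation x1 := ('X_(pos1 i) : R).
Local Notation x2 := ('X_(pos2 i) : R).
Implicit Types f g u : R.

(* [hecke f g] says T_i f = g, with denominators cleared. *)
Definition hecke f g : Prop :=
  (x1 - x2) * (t *: f - g) = (t *: x1 - x2) * (f - msym (s i) f).

Lemma msym_s_X c : msym (s i) ('X_c : R) = 'X_(s i c).
Proof.
rewrite msymX; congr mpolyX; apply/mnmP => d; rewrite mnmE !mnm1E.
by rewrite -(can2_eq (permK (s i)) (permKV (s i))).
Qed.

Lemma msym_sK f : msym (s i) (msym (s i) f) = f.
Proof. by rewrite -msymMm /s tperm2 msym1m. Qed.

Lemma x12_neq0 : x1 - x2 != 0.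
Proof.
rewrite subr_eq0; apply/eqP => /mpolyP/(_ U_(pos1 i)%MM).
rewrite !mcoeffXU eqxx eq_sym (negPf (pos12_neq i)) => /eqP.
by rewrite oner_eq0.
Qed.

Lemma hecke0 : hecke 0 0.
Proof. by rewrite /hecke msym0 scaler0 subr0 !mulr0. Qed.

Lemma heckeD f g f' g' : hecke f g -> hecke f' g' -> hecke (f + f') (g + g').
Proof.
rewrite /hecke msymD scalerDr => h h'.
rewrite (_ : _ - (g + g') = (t *: f - g) + (t *: f' - g')); last by ring.
by rewrite mulrDr h h'; ring.
Qed.

Lemma heckeZ a f g : hecke f g -> hecke (a *: f) (a *: g).
Proof.
rewrite /hecke msymZ -!mul_mpolyC => h.
transitivity (a%:MP * ((x1 - x2) * (t%:MP * f - g))); first by ring.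
by rewrite h; ring.
Qed.

Lemma hecke_sum I (r : seq I) (P : pred I) (f g : I -> R) :
  (forall j, P j -> hecke (f j) (g j)) ->
  hecke (\sum_(j <- r | P j) f j) (\sum_(j <- r | P j) g j).
Proof.
move=> h; apply: (big_ind2 hecke) => //; first exact: hecke0.
by move=> ? ? ? ?; apply: heckeD.
Qed.

Lemma hecke_sym_mul u f g : msym (s i) u = u -> hecke f g -> hecke (u * f) (u * g).
Proof.
rewrite /hecke msymM => -> h.
by rewrite scalerAr -!mulrBr mulrCA h mulrCA.
Qed.

(* The quadratic relation (T_i - t)(T_i + 1) = 0. *)
Lemma hecke_quadratic f g : hecke f g -> hecke g ((t - 1) *: g + t *: f).
Proof.
rewrite /hecke => h.
have := congr1 (msym (s i)) h; rewrite !(msymM, msymB, msymZ, msym_s_X, msym_sK).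
rewrite /s tpermL tpermR => h'.
(* h' is h with the two variables exchanged. After one more factor x_i - x_(i+1), the goal becomes a
   combination of h and h'. *)
apply: (mulfI x12_neq0); move: h h'; rewrite -!mul_mpolyC mpolyCB mpolyC1.
move: (t%:MP) (msym _ f) (msym _ g) => T sf sg h h'.
have {}h : (x1 - x2) * g = (x1 - x2) * (T * f) - (T * x1 - x2) * (f - sf).
  by rewrite -h; ring.
have {}h' : (x1 - x2) * sg = (x1 - x2) * (T * sf) + (T * x2 - x1) * (sf - f).
  by rewrite -h'; ring.
transitivity ((x1 - x2) * ((x1 - x2) * g - (x1 - x2) * (T * f))); first by ring.
transitivity ((T * x1 - x2) * ((x1 - x2) * g - (x1 - x2) * sg)); last by ring.
by rewrite h h'; ring.
Qed.

(* T_i x_i = x_{i+1} (T_i + 1 - t) *)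
Lemma hecke_mul_X f g : hecke f g -> hecke (x1 * f) (x2 * (g + (1 - t) *: f)).
Proof.
rewrite /hecke msymM msym_s_X /s tpermL -!mul_mpolyC mpolyCB mpolyC1.
move: (t%:MP) (msym _ f) => T sf h.
transitivity (x2 * ((x1 - x2) * (T * f - g)) + (T * x1 - x2) * (x1 - x2) * f).
  by ring.
by rewrite h; ring.
Qed.

End HeckeRelation.

Section RotOperator.

Variables (k : fieldType) (q : k) (n : nat).

Definition rotp (f : {mpoly k[n.+1]}) : {mpoly k[n.+1]} :=
  f \mPo [tuple (if j == ord0 then q else 1) *: 'X_(ord_pred j) | j < n.+1].

Lemma rotpZ a f : rotp (a *: f) = a *: rotp f.
Proof. exact: comp_mpolyZ. Qed.

Lemma rotpM f g : rotp (f * g) = rotp f * rotp g.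
Proof. exact: rmorphM. Qed.

Lemma rotpX c : rotp 'X_c = (if c == ord0 then q else 1) *: 'X_(ord_pred c).
Proof.
by rewrite /rotp comp_mpolyXU -tnth_nth tnth_mktuple.
Qed.

End RotOperator.

Section RowMonomial.

Variables (k : fieldType) (n : nat).

Definition row_mon (mu : 'I_n.+1 -> nat) : {mpoly k[n.+1]} :=
  \prod_(c < n.+1) 'X_c ^+ (0 < mu c)%N.

Definition away_mon (i : 'I_n) (mu : 'I_n.+1 -> nat) : {mpoly k[n.+1]} :=
  \prod_(c < n.+1 | (c != pos1 i) && (c != pos2 i)) 'X_c ^+ (0 < mu c)%N.

Lemma row_monE i mu : row_mon mu =
  'X_(pos1 i) ^+ (0 < mu (pos1 i))%N * 'X_(pos2 i) ^+ (0 < mu (pos2 i))%N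
  * away_mon i mu.
Proof.
rewrite /row_mon (bigD1 (pos1 i)) //= (bigD1 (pos2 i)) /= ?mulrA //.
by rewrite eq_sym pos12_neq.
Qed.

Lemma away_mon_swap i mu : away_mon i (swap_comp i mu) = away_mon i mu.
Proof. by apply: eq_bigr => c /andP[c1 c2]; rewrite swap_compD. Qed.

Lemma msym_away_mon i mu : msym (s i) (away_mon i mu) = away_mon i mu.
Proof.
rewrite /away_mon rmorph_prod; apply: eq_bigr => c /andP[c1 c2] /=.
by rewrite rmorphXn /= msym_s_X /s tpermD // eq_sym.
Qed.

Lemma rotp_row_mon (q : k) mu :
  rotp q (row_mon (rot_comp mu)) = q ^+ (0 < mu ord_max)%N *: row_mon mu.
Proof.
rewrite /row_mon /rotp rmorph_prod /= big_ord_recl [in RHS]big_ord_recr /=.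
rewrite mulrC scalerAr; congr (_ * _).
  apply: eq_bigr => c _; rewrite rmorphXn /= -/(rotp q _) rotpX /=.
  by rewrite scale1r /rot_comp ord_pred_lift.
by rewrite rmorphXn /= -/(rotp q _) rotpX eqxx /rot_comp ord_pred0 exprZn.
Qed.

End RowMonomial.

Section RowExtensionality.

Variables (k : fieldType) (q t : k) (n L rr : nat).
Implicit Types (la mu : 'I_n -> nat).

Lemma eq_row_ok b mu mu' : mu =1 mu' -> row_ok b mu = row_ok b mu'.
Proof. by move=> e; apply: eq_forallb => c; rewrite e. Qed.

Lemma eq_row_prod la la' mu mu' : la =1 la' -> mu =1 mu' ->
  row_prod q t L rr la mu = row_prod q t L rr la' mu'.
Proof.
move=> ela emu.
have card (P : pred nat) (f f' : 'I_n -> nat) : f =1 f' ->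
    #|[set e | P (f e)]| = #|[set e | P (f' e)]|.
  by move=> ef; apply: eq_card => e; rewrite !inE ef.
rewrite /row_prod (eq_row_ok _ emu) (_ : row_balanced _ _ _ _ = row_balanced L rr la' mu').
  case: ifP => // _; apply: eq_bigr => j _; rewrite /lev (card (fun x => 0 < x < j)%N _ _ emu).
  congr (_ * tau _ _ _); apply: eq_bigr => c _; rewrite ela emu; congr cfac.
  by congr (_ ^ _); apply: eq_bigr => c' _; rewrite ela emu.
apply: eq_forallb => j; rewrite /balanced_at.
by rewrite (card (pred1 (j : nat)) _ _ ela) (card (pred1 (j : nat)) _ _ emu).
Qed.

End RowExtensionality.

(** * Adding one row at the bottom *)

Section Step.

Variables (k : fieldType) (q t : k) (n L : nat).
Hypothesis t_neq0 : t != 0.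
Hypothesis qt_neq1 : forall e m, (0 < e)%N -> 1 - q ^+ e * t ^+ m != 0.

Local Notation V := {ffun 'I_n.+1 -> 'I_L.+1}.
Local Notation R := {mpoly k[n.+1]}.

Definition labels (v : V) : 'I_n.+1 -> nat := fun c => v c.
Definition swapv (i : 'I_n) (v : V) : V := [ffun c => v (s i c)].
Definition rotv (v : V) : V := [ffun c => v (ord_pred c)].

Lemma labels_le v c : (labels v c <= L)%N.
Proof. by rewrite -ltnS ltn_ord. Qed.

Lemma labels_swap i v : labels (swapv i v) =1 swap_comp i (labels v).
Proof. by move=> c; rewrite /labels ffunE. Qed.

Lemma labels_rot v : labels (rotv v) =1 rot_comp (labels v).
Proof. by move=> c; rewrite /labels ffunE. Qed.

Lemma swapvK i : involutive (swapv i).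
Proof. by move=> v; apply/ffunP => c; rewrite !ffunE tpermK. Qed.

Lemma rotv_inj : injective rotv.
Proof.
move=> v v' /ffunP e; apply/ffunP => c.
by have := e (ordS c); rewrite !ffunE ordSK.
Qed.

(* The three relations for the generating polynomial g v of the rows from row
   number rb upwards, when row rb has labels v. *)
Record qkz (rb : nat) (g : V -> R) : Prop := Qkz {
  qkz_gt : forall (i : 'I_n) (v : V), (v (pos2 i) < v (pos1 i))%N -> hecke t i (g v) (g (swapv i v));
  qkz_eq : forall (i : 'I_n) (v : V), v (pos1 i) = v (pos2 i) -> hecke t i (g v) (t *: g v);
  qkz_rot : forall v : V, q ^+ (v ord_max - rb.-1) *: g v = rotp q (g (rotv v))
}.

Variables (rr : nat) (g : V -> R) (b : pred V).
Hypothesis rr_gt1 : (1 < rr)%N.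
Hypothesis g_qkz : qkz rr g.
Hypothesis b_swap : forall i v, b (swapv i v) = b v.
Hypothesis b_rot : forall v, b (rotv v) = b v.

Definition row_coef (w v : V) : k :=
  if row_ok rr (labels w) then row_prod q t L rr (labels w) (labels v) else 0.

(** The guard b requires the top row to be nonempty; for the other rows it is [predT]. *)
Definition row_step (v : V) : R :=
  if b v then row_mon k (labels v) * \sum_w row_coef w v *: g w else 0.

Lemma row_ok_swapv c i w : row_ok c (labels (swapv i w)) = row_ok c (labels w).
Proof. by rewrite (eq_row_ok _ (labels_swap i w)) row_ok_swap. Qed.

Definition hecke_row_coef i (w v : V) : k :=
  if row_ok rr (labels w) then hecke_coef q t L rr i (labels w) (labels v) else 0.

(** Each T_i g_w equals al w g_w + be w g_(s_i w), by the relations for g and, when w_i < w_(i+1),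
    by the quadratic relation. Reindexing the second part by the swap collects the coefficient of
    g_w. *)
Lemma hecke_row_sum i v : hecke t i (\sum_w row_coef w v *: g w)
  (\sum_w hecke_row_coef i w v *: g w).
Proof.
pose al (w : V) := if w (pos1 i) == w (pos2 i) then t
             else if (w (pos2 i) < w (pos1 i))%N then 0 else t - 1.
pose be (w : V) := if w (pos1 i) == w (pos2 i) then 0
             else if (w (pos2 i) < w (pos1 i))%N then 1 else t.
rewrite [X in hecke _ _ _ X](_ : _ =
    \sum_w row_coef w v *: (al w *: g w + be w *: g (swapv i w))); last first.
  under [in RHS]eq_bigr => w _ do rewrite scalerDr !scalerA.
  rewrite big_split /= [X in _ = _ + X](reindex_inj (inv_inj (swapvK i))) /=.
  rewrite -big_split /=; apply: eq_bigr => w _; rewrite swapvK -scalerDl; congr (_ *: _).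
  rewrite /hecke_row_coef /row_coef row_ok_swapv; case: ifP => _; last by rewrite !mul0r addr0.
  rewrite (eq_row_prod _ _ _ _ (labels_swap i w) (frefl _)) /hecke_coef /al /be !ffunE.
  rewrite /s tpermL tpermR -!val_eqE /labels /=.
  by case: (ltngtP (w (pos1 i)) (w (pos2 i))) => _ /=; ring.
apply: hecke_sum => w _; apply: heckeZ; rewrite /al /be.
case: eqP => [eq_w|/eqP]; first by rewrite scale0r addr0; apply: qkz_eq g_qkz _ _ eq_w.
rewrite -val_eqE /= neq_ltn => /orP[lt_w|lt_w]; last first.
  by rewrite lt_w scale0r add0r scale1r; apply: qkz_gt g_qkz _ _ lt_w.
rewrite ltnNge ltnW //=; apply: hecke_quadratic.
rewrite -{2}[w](swapvK i); apply: (qkz_gt g_qkz).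
by rewrite !ffunE /s tpermL tpermR.
Qed.

Lemma row_mon_swapv (i : 'I_n) (v : V) : row_mon k (labels (swapv i v)) =
  'X_(pos1 i) ^+ (0 < v (pos2 i))%N * 'X_(pos2 i) ^+ (0 < v (pos1 i))%N
  * away_mon k i (labels v).
Proof.
rewrite (row_monE k i); congr (_ * _).
  by rewrite !labels_swap swap_comp1 swap_comp2.
by rewrite -[RHS]away_mon_swap; apply: eq_bigr => c _; rewrite labels_swap.
Qed.

Lemma row_coef_swapv i w v : row_coef w (swapv i v) =
  if row_ok rr (labels w) then row_prod q t L rr (labels w) (swap_comp i (labels v)) else 0.
Proof. by rewrite /row_coef (eq_row_prod _ _ _ _ (frefl _) (labels_swap i v)). Qed.

Lemma row_step_qkz : qkz rr.-1 row_step.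
Proof.
have Lle v c := labels_le v c.
split=> [i v lt_v|i v eq_v|v].
- rewrite /row_step b_swap; case: ifP => _; last exact: hecke0.
  rewrite (row_monE k i) row_mon_swapv -/(labels v (pos1 i)) -/(labels v (pos2 i)).
  have v1 : (0 < labels v (pos1 i))%N by apply: leq_ltn_trans lt_v.
  case: (posnP (labels v (pos2 i))) => [v2|v2]; rewrite v1 !expr1.
    (* Only x_i occurs in the row monomial, so T_i turns it into x_(i+1) at the cost of an extra
       term. *)
    rewrite expr0 mulr1 mul1r -!mulrA [_ * (away_mon _ _ _ * _)]mulrCA.
    rewrite ['X_(pos2 i) * _]mulrCA; apply: hecke_sym_mul; first exact: msym_away_mon.
    rewrite [X in hecke _ _ _ ('X_(pos2 i) * X)](_ : _ =
      \sum_w hecke_row_coef i w v *: g w + (1 - t) *: \sum_w row_coef w v *: g w).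
      exact/hecke_mul_X/hecke_row_sum.
    rewrite scaler_sumr -big_split /=; apply: eq_bigr => w _.
    rewrite scalerA -scalerDl row_coef_swapv /hecke_row_coef /row_coef.
    case: ifP => ok_w; last by rewrite mulr0 addr0.
    by rewrite row_prod_swap_zero.
  (* Here both variables occur, the row monomial is symmetric in them and commutes with T_i. *)
  apply: hecke_sym_mul.
    rewrite !msymM msym_away_mon !msym_s_X /s tpermL tpermR; congr (_ * _).
    exact: mulrC.
  rewrite [X in hecke _ _ _ X](_ : _ = \sum_w hecke_row_coef i w v *: g w).
    exact: hecke_row_sum.
  apply: eq_bigr => w _; rewrite row_coef_swapv /hecke_row_coef; case: ifP => // ok_w.
  by rewrite row_prod_swap_pos // v2.
- rewrite /row_step; case: ifP => _; last by rewrite scaler0; exact: hecke0.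
  rewrite scalerAr (row_monE k i) -/(labels v (pos1 i)); apply: hecke_sym_mul.
    rewrite !msymM msym_away_mon !rmorphXn /= !msym_s_X /s tpermL tpermR.
    by rewrite /labels eq_v; congr (_ * _); exact: mulrC.
  rewrite [X in hecke _ _ _ X](_ : _ = \sum_w hecke_row_coef i w v *: g w).
    exact: hecke_row_sum.
  rewrite scaler_sumr; apply: eq_bigr => w _; rewrite scalerA /hecke_row_coef /row_coef.
  case: ifP => ok_w; last by rewrite mulr0.
  by rewrite hecke_coef_eq // /labels eq_v.
rewrite /row_step b_rot; case: ifP => _; last by rewrite scaler0 /rotp rmorph0.
rewrite rotpM (_ : row_mon k (labels (rotv v)) = row_mon k (rot_comp (labels v))); last first.
  by apply: eq_bigr => c _; rewrite labels_rot.
rewrite rotp_row_mon /rotp rmorph_sum /= [in RHS](reindex_inj rotv_inj) /=.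
rewrite scalerAr -scalerAl scalerAr; congr (_ * _); rewrite !scaler_sumr.
apply: eq_bigr => w _; rewrite -/(rotp q _) rotpZ -(qkz_rot g_qkz) !scalerA; congr (_ *: _).
rewrite /row_coef (eq_row_ok _ (labels_rot w)) row_ok_rot.
case: ifP => ok_w; last by rewrite !(mulr0, mul0r).
rewrite (eq_row_prod _ _ _ _ (labels_rot w) (labels_rot v)).
have /= := row_prod_rot t_neq0 qt_neq1 rr_gt1 (Lle w) (Lle v); rewrite {2 4}/labels.
rewrite -!mulrA => ->; rewrite mulrCA mulrC.
rewrite /row_prod; case: ifP => [/andP[/row_okP ok_v _]|_]; last by rewrite !mul0r.
(* At a ball, v_n - (rr - 1) from the matching and 1 from q x_n add up to v_n - (rr - 2); at an
   empty position both sides are 0. *)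
rewrite -exprD; congr (_ * _ ^+ _).
by have := ok_v ord_max; rewrite /labels; lia.
Qed.

End Step.

(** * Stacking the rows *)

Section RowRecursion.

Variables (k : fieldType) (q t : k) (n L : nat).
Hypothesis t_neq0 : t != 0.
Hypothesis qt_neq1 : forall e m, (0 < e)%N -> 1 - q ^+ e * t ^+ m != 0.

Local Notation V := {ffun 'I_n.+1 -> 'I_L.+1}.
Local Notation R := {mpoly k[n.+1]}.

Definition nonempty_row (v : V) : bool := [exists c, (0 < v c)%N].

Definition top_poly (v : V) : R :=
  if row_ok L (labels v) && nonempty_row v then row_mon k (labels v) else 0.

(** Here rb is the number of the bottom row and m counts the rows above it. *)
Fixpoint rows_poly (m rb : nat) (v : V) : R :=
  if m is m'.+1 then row_step q t rb.+1 (rows_poly m' rb.+1) predT v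
  else top_poly v.

Definition no_rows_poly (v : V) : R := if nonempty_row v then 0 else 1.

Lemma nonempty_swap i v : nonempty_row (swapv i v) = nonempty_row v.
Proof.
apply/existsP/existsP => -[c]; first by rewrite ffunE; exists (s i c).
by exists (s i c); rewrite ffunE tpermK.
Qed.

Lemma nonempty_rot v : nonempty_row (rotv v) = nonempty_row v.
Proof.
apply/existsP/existsP => -[c]; first by rewrite ffunE; exists (ord_pred c).
by exists (ordS c); rewrite ffunE ordSK.
Qed.

Lemma no_rows_qkz : qkz q t L.+1 no_rows_poly.
Proof.
split=> [i v lt_v|i v _|v]; rewrite /no_rows_poly.
- rewrite nonempty_swap (_ : nonempty_row v); first exact: hecke0.
  by apply/existsP; exists (pos1 i); apply: leq_ltn_trans lt_v.
- case: ifP => _; first by rewrite scaler0; exact: hecke0.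
  by rewrite /hecke msym1 subrr mulr0 subrr mulr0.
- rewrite nonempty_rot; case: ifP => [_|nz]; first by rewrite scaler0 /rotp rmorph0.
  rewrite (_ : v ord_max = 0 :> nat)%N ?sub0n ?expr0 ?scale1r /rotp ?rmorph1 //.
  by apply/eqP; rewrite -leqn0 leqNgt; apply: contraFN nz => h; apply/existsP; exists ord_max.
Qed.

(** Row L is treated as a step below an imaginary empty row L + 1, so the base of the induction is
    an instance of the step. *)
Lemma top_poly_step v : top_poly v = row_step q t L.+1 no_rows_poly nonempty_row v.
Proof.
rewrite /row_step /top_poly andbC; case: ifP => [/andP[-> ok_v]|]; last first.
  case: ifP => //= nz /negP nok.
  rewrite big1 ?mulr0 // => w _; rewrite /row_coef /row_prod /=.
  by case: (row_ok L (labels v)) nok => // _; rewrite if_same scale0r.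
rewrite (bigD1 [ffun=> ord0]) //= big1 => [|w w0]; last first.
  rewrite /no_rows_poly (_ : nonempty_row w) ?scaler0 //.
  apply: contraR w0; rewrite negb_exists => /forallP nz; apply/eqP/ffunP => c; rewrite ffunE.
  by apply/val_inj/eqP; rewrite /= -leqn0 leqNgt.
rewrite /no_rows_poly (_ : nonempty_row _ = false) ?addr0; last first.
  by apply/existsP => -[c]; rewrite ffunE.
rewrite /row_coef (_ : row_ok _ _); last first.
  by apply/row_okP => c; left; rewrite /labels ffunE.
rewrite /row_prod ok_v (_ : row_balanced _ _ _ _); last first.
  by apply/forallP => j; rewrite leqNgt ltn_ord.
rewrite big1 ?scale1r ?mulr1 // => j.
by rewrite leqNgt ltn_ord.
Qed.

Lemma eq_qkz rb (g h : V -> R) : g =1 h -> qkz q t rb h -> qkz q t rb g.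
Proof. by move=> e [h1 h2 h3]; split=> *; rewrite !e; auto. Qed.

Lemma rows_poly_qkz m rb : (0 < rb)%N -> (rb + m = L)%N -> qkz q t rb (rows_poly m rb).
Proof.
elim: m rb => [|m IHm] rb rb_gt0 rbm.
  have -> : rb = L by lia.
  apply: eq_qkz top_poly_step _.
  apply: (row_step_qkz t_neq0 qt_neq1 _ no_rows_qkz); first by lia.
    exact: nonempty_swap.
  exact: nonempty_rot.
apply: (@eq_qkz rb _ (row_step q t rb.+1 (rows_poly m rb.+1) predT)) => //.
apply: (@row_step_qkz _ _ _ _ _ t_neq0 qt_neq1 rb.+1) => //.
by apply: IHm => //; lia.
Qed.

Definition path_weight m rb (f : {ffun 'I_m.+1 -> V}) : R :=
  (\prod_(j < m) row_coef q t (rb + j).+1 (f (lift ord0 j)) (f (widen_ord (leqnSn m) j))) *: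
  (if row_ok L (labels (f ord_max)) && nonempty_row (f ord_max)
   then \prod_(r < m.+1) row_mon k (labels (f r)) else 0).

Definition cons_row m (v : V) (f : {ffun 'I_m.+1 -> V}) : {ffun 'I_m.+2 -> V} :=
  [ffun j => if unlift ord0 j is Some j' then f j' else v].
Definition behead_row m (f : {ffun 'I_m.+2 -> V}) : {ffun 'I_m.+1 -> V} :=
  [ffun j => f (lift ord0 j)].

Lemma cons_row0 m v (f : {ffun 'I_m.+1 -> V}) : cons_row v f ord0 = v.
Proof. by rewrite ffunE unlift_none. Qed.

Lemma cons_rowS m v (f : {ffun 'I_m.+1 -> V}) j : cons_row v f (lift ord0 j) = f j.
Proof. by rewrite ffunE liftK. Qed.

Lemma path_weight_cons m rb v (f : {ffun 'I_m.+1 -> V}) :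
  path_weight rb (cons_row v f) =
  row_mon k (labels v) * (row_coef q t rb.+1 (f ord0) v *: path_weight rb.+1 f).
Proof.
rewrite /path_weight big_ord_recl [in RHS]scalerA -scalerAr.
have -> : ord_max = lift ord0 ord_max :> 'I_m.+2 by apply: val_inj.
rewrite cons_rowS addn0 (_ : widen_ord _ ord0 = ord0); last exact: val_inj.
rewrite cons_row0 cons_rowS; congr (_ * _ *: _).
  apply: eq_bigr => j _; rewrite cons_rowS.
  rewrite (_ : widen_ord _ _ = lift ord0 (widen_ord (leqnSn m) j)); last exact: val_inj.
  by rewrite cons_rowS /= /bump leq0n add1n addnS addSn.
case: ifP => _; last by rewrite mulr0.
by rewrite big_ord_recl cons_row0; congr (_ * _); apply: eq_bigr => j _; rewrite cons_rowS.
Qed.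

Lemma rows_polyE m rb v :
  rows_poly m rb v = \sum_(f : {ffun 'I_m.+1 -> V} | f ord0 == v) path_weight rb f.
Proof.
elim: m rb v => [|m IHm] rb v.
  rewrite (big_pred1 [ffun=> v]) => [|f]; last first.
    by apply/eqP/eqP => [<-|->]; [apply/ffunP => j; rewrite ffunE ord1|rewrite ffunE].
  by rewrite /path_weight big_ord0 scale1r ffunE big_ord1 ffunE.
rewrite /= /row_step /= (reindex_onto (cons_row v) (@behead_row m)) /=; last first.
  move=> f /eqP f0; apply/ffunP => j; rewrite !ffunE.
  by case: unliftP => [j' ->|->]; rewrite ?ffunE.
rewrite [RHS](eq_bigl xpredT) => [|f]; last first.
  rewrite cons_row0 eqxx /=; apply/eqP/ffunP => j; by rewrite ffunE cons_rowS.
rewrite [RHS](partition_big (fun f : {ffun 'I_m.+1 -> V} => f ord0) xpredT) //= big_distrr /=.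
apply: eq_bigr => w _; rewrite IHm scaler_sumr big_distrr /=; apply: eq_bigr => f /eqP f0.
by rewrite path_weight_cons f0.
Qed.

End RowRecursion.

(** * Multiline queues *)

Section MultilineQueueRows.

Variables (L' n : nat).
Local Notation L := L'.+1.
Local Notation V := {ffun 'I_n -> 'I_L.+1}.
Implicit Types (Q : mlq_data L n) (r : 'I_L) (c d : 'I_n).

Record mlq_spec Q : Prop := MlqSpec {
  mlq_top : balls Q ord_max != set0;
  mlq_card : forall r, (0 < r)%N -> (#|balls Q r| <= #|balls Q (below r)|)%N;
  mlq_some : forall r c, (0 < r)%N -> c \in balls Q r ->
    exists2 d, d \in balls Q (below r) & link Q r c = Some d;
  mlq_none : forall r c, ~~ ((0 < r)%N && (c \in balls Q r)) -> link Q r c = None;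
  mlq_inj : forall r c1 c2 d, link Q r c1 = Some d -> link Q r c2 = Some d -> c1 = c2;
  mlq_label0 : forall r c, c \notin balls Q r -> label Q r c = 0%N :> nat;
  mlq_label_top : forall c, c \in balls Q ord_max -> label Q ord_max c = L :> nat;
  mlq_label_link : forall r c d, link Q r c = Some d ->
    label Q (below r) d = label Q r c;
  mlq_label_free : forall r d, (0 < r)%N -> d \in balls Q (below r) ->
    (forall c, link Q r c <> Some d) -> label Q (below r) d = r :> nat;
  mlq_trivial : forall r c, (0 < r)%N -> c \in balls Q r ->
    c \in free_balls Q r c -> link Q r c = Some c
}.

Lemma rownum_below r : (0 < r)%N -> rownum (below r) = r.
Proof.
move=> r_gt0; rewrite /rownum /below /=.
have lt_r := ltn_ord r; move: r_gt0 lt_r; case: (nat_of_ord r) => // m _ lt_m.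
by rewrite /= modnDr modn_small // ltnW.
Qed.

Lemma rownum_top r : (rownum r == L) = (r == ord_max).
Proof. by rewrite -val_eqE. Qed.

Lemma is_mlqP Q : reflect (mlq_spec Q) (is_mlq Q).
Proof.
apply: (iffP and4P) => [[/andP[/forallP t1 /forallP t2] /andP[/forallP m1 /forallP m2]
   /and4P[/forallP l1 /forallP l2 /forallP l3 /forallP l4] /forallP tr]|].
  split.
  - by have := t1 ord_max; rewrite rownum_top eqxx.
  - by move=> r r_gt0; have := t2 r; rewrite r_gt0.
  - move=> r c r_gt0 c_r; have /forallP/(_ c) := m1 r; rewrite r_gt0 c_r /=.
    by case/exists_inP => d d_r /eqP; exists d.
  - by move=> r c /negPf nrc; have /forallP/(_ c) := m1 r; rewrite nrc => /eqP.
  - move=> r c1 c2 d f1 f2; have /forallP/(_ c1)/forallP/(_ c2)/forallP/(_ d) := m2 r.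
    by rewrite f1 f2 eqxx => /eqP.
  - by move=> r c c_r; have /forallP/(_ c) := l1 r; rewrite c_r => /eqP.
  - move=> c c_r; have /forallP/(_ c) := l2 ord_max.
    by rewrite c_r rownum_top eqxx => /eqP.
  - by move=> r c d f; have /forallP/(_ c)/forallP/(_ d) := l3 r; rewrite f eqxx => /eqP.
  - move=> r d r_gt0 d_r nf; have /forallP/(_ d) := l4 r.
    rewrite d_r r_gt0 rownum_below // (_ : [forall c, _]) => [/eqP //|].
    by apply/forallP => c; apply/eqP.
  - by move=> r c r_gt0 c_r fr; have /forallP/(_ c) := tr r; rewrite c_r r_gt0 fr => /eqP.
move=> [h1 h2 h3 h4 h5 h6 h7 h8 h9 h10]; split.
- apply/andP; split; apply/forallP => r; apply/implyP; last exact: h2.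
  by rewrite rownum_top => /eqP->.
- apply/andP; split; apply/forallP => r; apply/forallP => c.
    case: ifP => [/andP[r_gt0 c_r]|/negbT/h4->//].
    by have [d d_r ->] := h3 _ _ r_gt0 c_r; apply/exists_inP; exists d.
  apply/forallP => c2; apply/forallP => d; apply/implyP => /andP[/eqP f1 /eqP f2].
  by rewrite (h5 _ _ _ _ f1 f2).
- apply/and4P; split; apply/forallP => r; apply/forallP => c.
  + by apply/implyP => /h6->.
  + apply/implyP => c_r; apply/implyP; rewrite rownum_top => /eqP rE.
    by rewrite rE in c_r *; rewrite h7.
  + by apply/forallP => d; apply/implyP => /eqP/h8->.
  + apply/implyP => d_r; apply/implyP => /andP[r_gt0 /forallP nf].
    by rewrite rownum_below // h9 // => c'; apply/eqP.
- apply/forallP => r; apply/forallP => c; apply/implyP => c_r.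
  by apply/implyP => /andP[r_gt0 fr]; rewrite h10.
Qed.

(** Descent from the top: a label is inherited from a higher row or is the row number itself. Hence
    balls are the positions of positive label, and [label] determines [balls]. *)
Lemma mlq_label_ge Q : mlq_spec Q -> forall r c, c \in balls Q r ->
  (rownum r <= label Q r c)%N.
Proof.
move=> sQ r; move: {2}(L' - r)%N (leqnn (L' - r)) => m.
elim: m r => [|m IHm] r le_m c c_r.
  have rE : r = ord_max by apply: val_inj => /=; have := ltn_ord r; lia.
  by rewrite rE in c_r *; rewrite (mlq_label_top sQ).
case: (eqVneq r ord_max) => [rE|rm].
  by rewrite rE in c_r *; rewrite (mlq_label_top sQ).
have lt_r : (r.+1 < L)%N.
  by have := ltn_ord r; move: rm; rewrite -val_eqE /=; lia.
pose r' := Ordinal lt_r.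
have bE : below r' = r.
  by apply: val_inj => /=; rewrite modnDr modn_small.
case: (pickP (fun c' => link Q r' c' == Some c)) => [c' /eqP fc'|nf].
  have c'_r : c' \in balls Q r'.
    apply/negPn/negP => nc'; have := mlq_none sQ (r := r') (c := c').
    by rewrite (negPf nc') fc' => /(_ isT).
  have := mlq_label_link sQ fc'; rewrite bE => ->.
  apply: leq_trans (IHm r' _ c' c'_r); first by rewrite /rownum /=.
  by rewrite /=; move: rm; rewrite -val_eqE /=; lia.
have := @mlq_label_free Q sQ r' c isT; rewrite bE => /(_ c_r) -> // c'.
by apply/eqP; rewrite nf.
Qed.

Definition label_support (lab : {ffun 'I_L -> V}) : {ffun 'I_L -> {set 'I_n}} :=
  [ffun r => [set c | (0 < lab r c)%N]].

Definition queue_of (p : {ffun 'I_L -> V} * {ffun 'I_L -> {ffun 'I_n -> option 'I_n}}) :=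
  MlqData (label_support p.1) p.2 p.1.

Lemma mlq_balls Q : mlq_spec Q -> queue_of (label Q, link Q) = Q.
Proof.
move=> sQ; case: Q sQ => bs lk lb sQ; rewrite /queue_of; congr MlqData.
apply/ffunP => r; rewrite ffunE; apply/setP => c; rewrite inE /=.
apply/idP/idP => [lb_c|c_r].
  apply/negPn/negP => nc; have := @mlq_label0 _ sQ r c nc; rewrite /=.
  by move: lb_c => /=; lia.
exact: leq_trans (mlq_label_ge sQ c_r).
Qed.

(** Row 1 has no links and needs its own case, since [below ord0] is cyclically the top row. *)
Definition row_link (lab : {ffun 'I_L -> V}) r (f : {ffun 'I_n -> option 'I_n}) : bool :=
  if r == ord0 then f == [ffun=> None]
  else row_matching (rownum r) (fun c => lab r c) (fun c => lab (below r) c) f.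

Lemma free_balls_queue lab lnk r c : free_balls (queue_of (lab, lnk)) r c =
  row_free (fun c => lab r c) (fun c => lab (below r) c) (lnk r) c.
Proof. by apply/setP => d; rewrite !inE /= ffunE inE. Qed.

(** Once all labels are fixed, the links of different rows are constrained independently, so the sum
    over links can factor. *)
Lemma queue_of_spec lab lnk : mlq_spec (queue_of (lab, lnk)) <->
  [/\ forall r, row_ok (rownum r) (fun c => lab r c),
      exists c, (0 < lab ord_max c)%N & forall r, row_link lab r (lnk r)].
Proof.
have inB r c : (c \in balls (queue_of (lab, lnk)) r) = (0 < lab r c)%N.
  by rewrite /= ffunE inE.
split=> [sQ|[ok [c0 nz] rl]].
  split.
  - move=> r; apply/row_okP => c; case: (posnP (lab r c)) => [|lab_c]; [by left|right].
    by have := @mlq_label_ge _ sQ r c; rewrite inB => /(_ lab_c).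
  - by have /set0Pn[c] := mlq_top sQ; rewrite inB; exists c.
  move=> r; rewrite /row_link; case: eqP => [->|/eqP r0].
    by apply/eqP/ffunP => c; rewrite ffunE; apply: (mlq_none sQ).
  have r_gt0 : (0 < r)%N by rewrite lt0n.
  apply/row_matchingP; split.
  - move=> c lab_c; have [|d] := @mlq_some _ sQ r c r_gt0; first by rewrite inB.
    by rewrite inB => ? ?; exists d.
  - move=> c lab_c; apply: (@mlq_none _ sQ r c).
    by rewrite inB lab_c andbF.
  - by move=> c1 c2 d; apply: (@mlq_inj _ sQ r).
  - by move=> c d /(@mlq_label_link _ sQ r) /= ->.
  - move=> d lab_d nf /=; apply: (@mlq_label_free _ sQ r) => //.
    by rewrite inB.
  - move=> c lab_c; rewrite -free_balls_queue => fr.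
    by apply: (@mlq_trivial _ sQ r c) => //; rewrite inB.
have rmP r : (0 < r)%N ->
    row_matching_spec (rownum r) (fun c => lab r c) (fun c => lab (below r) c) (lnk r).
  by move=> r_gt0; apply/row_matchingP; have := rl r; rewrite /row_link -val_eqE gtn_eqF.
have link0 r c : r = ord0 -> lnk r c = None.
  by move=> r0; have := rl r; rewrite /row_link r0 eqxx => /eqP ->; rewrite ffunE.
have link_pos r c d : lnk r c = Some d -> (0 < r)%N.
  rewrite lt0n => f; apply/negP => r0; move: f; rewrite link0 //.
  by apply: val_inj; apply/eqP.
have somer r c : (0 < r)%N -> (0 < lab r c)%N ->
    exists2 d, (0 < lab (below r) d)%N & lnk r c = Some d.
  by move=> r_gt0; apply: (rm_some (rmP r r_gt0)).
split.
- by apply/set0Pn; exists c0; rewrite inB.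
(* The inequality between ball counts follows from the injectivity of the links. *)
- move=> r r_gt0; pose tgt c := odflt c (lnk r c).
  rewrite -(card_in_imset (f := tgt) (D := balls (queue_of (lab, lnk)) r)).
    apply: subset_leq_card; apply/subsetP => _ /imsetP[c + ->]; rewrite !inB => lab_c.
    by have [d lab_d fd] := somer _ _ r_gt0 lab_c; rewrite /tgt fd.
  move=> c1 c2; rewrite !inB => lab1 lab2.
  have [d1 _ f1] := somer _ _ r_gt0 lab1; have [d2 _ f2] := somer _ _ r_gt0 lab2.
  rewrite /tgt f1 f2 /= => d12; rewrite -d12 in f2.
  exact: (rm_inj (rmP r r_gt0) f1 f2).
- move=> r c r_gt0; rewrite inB => lab_c; have [d lab_d fd] := somer _ _ r_gt0 lab_c.
  by exists d; rewrite ?inB.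
- move=> r c; rewrite inB negb_and -!leqNgt leqn0 => /orP[r0|lab0].
    by apply: link0; apply: val_inj; apply/eqP.
  case: (posnP r) => [r0|r_gt0]; first by apply: link0; apply: val_inj.
  by apply: (rm_none (rmP r r_gt0)); lia.
- move=> r c1 c2 d f1; exact: (rm_inj (rmP r (link_pos _ _ _ f1)) f1).
- by move=> r c; rewrite inB -leqNgt leqn0 => /eqP.
- move=> c; rewrite inB => lab_c; case: (row_okP _ _ (ok ord_max) c) => [|le_L]; first by lia.
  by apply/eqP; rewrite eqn_leq -ltnS ltn_ord.
- move=> r c d f; apply: val_inj => /=.
  exact: (rm_label (rmP r (link_pos _ _ _ f)) f).
- move=> r d r_gt0; rewrite inB => lab_d nf.
  exact: (rm_free (rmP r r_gt0) lab_d nf).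
- move=> r c r_gt0; rewrite inB free_balls_queue => lab_c fr.
  exact: (rm_trivial (rmP r r_gt0) lab_c fr).
Qed.

Lemma has_typeE Q (v : V) : has_type Q (fun c => v c) = (label Q ord0 == v).
Proof.
apply/forallP/eqP => [h|<- r].
  have /forallP h0 := h ord0; apply/ffunP => c; apply: val_inj; exact/eqP/h0.
apply/implyP => /eqP[r0]; apply/forallP => c; rewrite (_ : r = ord0) //.
exact: val_inj.
Qed.

End MultilineQueueRows.

Lemma tvar_neq0 : tvar != 0.
Proof.
rewrite tofrac_eq0; apply/eqP => /mpolyP/(_ U_(ord_max)%MM).
by rewrite mcoeffXU eqxx mcoeff0 => /eqP; rewrite oner_eq0.
Qed.

(** At q = t = 0 the polynomial takes the value 1. *)
Lemma qt_neq1 e m : (0 < e)%N -> 1 - qvar ^+ e * tvar ^+ m != 0.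
Proof.
move=> e_gt0; rewrite /qvar /tvar -!tofracXn -tofracM -tofrac1 -tofracB tofrac_eq0.
apply/eqP => /(congr1 (meval (fun=> 0))).
rewrite mevalB meval1 mevalM !rmorphXn /= !mevalXU expr0n gtn_eqF // mul0r subr0 meval0.
by move/eqP; rewrite oner_eq0.
Qed.

(** * The sum over queues and the three relations for F *)

Section QueueSum.

Variables (L' n : nat).
Local Notation L := L'.+1.
Local Notation V := {ffun 'I_n.+1 -> 'I_L.+1}.
Local Notation links := {ffun 'I_L -> {ffun 'I_n.+1 -> option 'I_n.+1}}.

Lemma wt_queue_of lab (lnk : links) :
  row_link lab ord0 (lnk ord0) ->
  wt (queue_of (lab, lnk)) =
  (\prod_(r < L) if r == ord0 then 1 else
     link_weight qvar tvar (rownum r) (labels (lab r)) (labels (lab (below r))) (lnk r))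
  *: \prod_(r < L) row_mon K (labels (lab r)).
Proof.
rewrite /row_link eqxx => /eqP lnk0; rewrite /wt; congr (_ *: _).
  apply: eq_bigr => r _; case: eqP => [->|_].
    by apply: big1 => c _; rewrite /= lnk0 ffunE.
  apply: eq_bigr => c _ /=; case: (lnk r c) => // d.
  rewrite /wt_pair /pair_weight /skipped free_balls_queue.
  by [].
rewrite /wt_x /row_mon exchange_big /=; apply: eq_bigr => c _.
rewrite prodrXr; congr (_ ^+ _); rewrite -sum1dep_card big_mkcond /=.
by apply: eq_bigr => r _; rewrite ffunE inE /labels; case: (0 < _)%N.
Qed.

Lemma queue_sum (v : V) :
  \sum_(Q : mlq_data L n.+1 | is_mlq Q && has_type Q (labels v)) wt Q =
  rows_poly qvar tvar L' 1 v.
Proof.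
rewrite rows_polyE.
rewrite (reindex_onto (@queue_of L' n.+1) (fun Q => (label Q, link Q))) /=; last first.
  by move=> Q /andP[/is_mlqP sQ _]; apply: mlq_balls.
pose lab_ok (lab : {ffun 'I_L -> V}) := [&& lab ord0 == v,
  [forall r, row_ok (rownum r) (labels (lab r))] & nonempty_row (lab ord_max)].
rewrite (eq_bigl (fun p : {ffun 'I_L -> V} * links =>
  lab_ok p.1 && [forall r, row_link p.1 r (p.2 r)])) => [|[lab lnk]]; last first.
  rewrite eqxx andbT has_typeE /= andbC /lab_ok -!andbA; case: eqP => //= _.
  apply/is_mlqP/and3P => [/queue_of_spec[ok [c nz] rl]|[/forallP ok /existsP nz /forallP rl]].
    by split; [apply/forallP | apply/existsP; exists c | apply/forallP].
  by apply/queue_of_spec.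
rewrite -(pair_big_dep lab_ok
  (fun lab (lnk : links) => [forall r, row_link lab r (lnk r)])
  (fun lab (lnk : links) => wt (queue_of (lab, lnk)))) /=.
rewrite big_mkcond [RHS]big_mkcond /=; apply: eq_bigr => lab _.
rewrite /lab_ok; case: eqP => //= _.
case: (boolP [forall r, row_ok (rownum r) (labels (lab r))])
  => [/forallP ok|/forallPn[r nok]]; last first.
  (* In row 1 every labelling is admissible; in a higher row the guard of [row_coef] makes the
     product vanish. *)
  rewrite /path_weight /=; case: (unliftP ord0 r) => [j rE|rE]; last first.
    case/negP: nok; rewrite rE; apply/row_okP => c; rewrite /rownum /=; lia.
  rewrite (bigD1 j) //= /row_coef -rE (_ : row_ok _ _ = false) ?mul0r ?scale0r //.
  by apply/negbTE; move: nok; rewrite rE /rownum /= /bump leq0n.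
rewrite /path_weight /= (_ : row_ok L (labels (lab ord_max))) /=; last exact: ok ord_max.
case: ifP => _; last by rewrite scaler0.
rewrite (eq_bigr (fun lnk : links =>
  (\prod_(r < L) if r == ord0 then 1 else
     link_weight qvar tvar (rownum r) (labels (lab r)) (labels (lab (below r))) (lnk r))
  *: \prod_(r < L) row_mon K (labels (lab r)))) => [|lnk /forallP rl]; last first.
  by rewrite wt_queue_of.
(* The monomial depends on the labels only, and the remaining sum over families of links distributes
   into one sum of matchings per row. *)
rewrite -scaler_suml; congr (_ *: _).
rewrite (eq_bigl (fun lnk : links => lnk \in family (fun r => row_link lab r))) => [|lnk]; last first.
  by apply/forallP/familyP.
rewrite -(bigA_distr_big_dep _ (fun r f => if r == ord0 then 1 else
     link_weight qvar tvar (rownum r) (labels (lab r)) (labels (lab (below r))) f)).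
rewrite big_ord_recl /= {1}/row_link eqxx big_pred1_eq mul1r.
apply: eq_bigr => j _; rewrite /row_coef.
rewrite (_ : row_ok _ _); last by have := ok (lift ord0 j); rewrite /rownum /= /bump leq0n.
rewrite -(row_sumE tvar_neq0 qt_neq1) //.
- rewrite /row_sum /row_link /= /below ord_pred_lift.
  by apply: eq_big => [f|f _] //.
- by have := ok (lift ord0 j); rewrite /rownum /= /bump leq0n.
- exact: labels_le.
- exact: labels_le.
Qed.

End QueueSum.

Lemma T_hecke (n : nat) (i : 'I_n) (f g : {mpoly K[n.+1]}) :
  hecke tvar i f g -> T i f = tofrac g.
Proof.
move=> h; have D0 : tofrac ('X_(pos1 i) - 'X_(pos2 i) : {mpoly K[n.+1]}) != 0.
  by rewrite tofrac_eq0 x12_neq0.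
rewrite /T mulrAC -tofracM -h tofracM mulrC mulKf // tofracB opprB addrCA subrr.
exact: addr0.
Qed.

Lemma F_rows_poly (n L' : nat) (mu : 'I_n.+1 -> nat) (v : {ffun 'I_n.+1 -> 'I_L'.+2}) :
  largest mu = L'.+1 -> mu =1 labels v -> F mu = rows_poly qvar tvar L' 1 v.
Proof.
move=> muL mu_v; rewrite /F muL -queue_sum; apply: eq_bigl => Q; congr (_ && _).
by apply: eq_forallb => r; congr (_ ==> _); apply: eq_forallb => c; rewrite mu_v.
Qed.

Lemma largest_swap (n : nat) (i : 'I_n) (mu : 'I_n.+1 -> nat) :
  largest (swap_comp i mu) = largest mu.
Proof. by rewrite /largest [RHS](reindex_inj (@perm_inj _ (s i))). Qed.

Lemma largest_rot (n : nat) (mu : 'I_n.+1 -> nat) : largest (rot_comp mu) = largest mu.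
Proof. by rewrite /largest [RHS](reindex_inj (@ord_pred_inj n)). Qed.

Theorem theorem1p22 (n : nat) (mu : 'I_n.+1 -> nat) (L_ge1 : (1 <= largest mu)%N) :
  (forall i : 'I_n,
     ((mu (pos1 i) > mu (pos2 i))%N -> T i (F mu) = tofrac (F (swap_comp i mu)))
     /\
     (mu (pos1 i) = mu (pos2 i) -> T i (F mu) = tofrac (tvar *: F mu)))
  /\
  qvar ^+ mu ord_max *: F mu = rot_poly (F (rot_comp mu)).
Proof.
case muL: (largest mu) L_ge1 => [//|L'] _.
pose v : {ffun 'I_n.+1 -> 'I_L'.+2} := [ffun c => inord (mu c)].
have mu_v : mu =1 labels v.
  by move=> c; rewrite /labels ffunE inordK // ltnS -muL leq_bigmax.
(* The bottom row has number 1, so the exponent in the rotation relation is mu_n itself. *)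
have [Hgt Heq Hrot] := @rows_poly_qkz _ _ _ n _ tvar_neq0 qt_neq1 L' 1 isT (add1n L').
rewrite (F_rows_poly muL mu_v); split=> [i|].
  split=> [lt_mu|eq_mu]; apply: T_hecke; last first.
    by apply/Heq/val_inj; move: eq_mu; rewrite !mu_v.
  rewrite (@F_rows_poly _ L' _ (swapv i v)) ?largest_swap // => [|c].
    by apply: Hgt; move: lt_mu; rewrite !mu_v.
  by rewrite labels_swap /swap_comp mu_v.
rewrite (@F_rows_poly _ L' _ (rotv v)) ?largest_rot // => [|c].
  by have := Hrot v; rewrite /= subn0 mu_v.
by rewrite labels_rot /rot_comp mu_v.
Qed.
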